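(* Let $\rho:\Gamma\to\mathsf{PGL}(E)$ be $k$-positive. Let $x_1,\dots,x_i\in\partial_\infty\Gamma$ be pairwise distinct and let $n_1,\dots,n_i$ be positive integers with $n_1+\dots+n_i\le d$ and $n_i\ge d-k$. Then the sum $$x_1^{n_1}+\dots+x_i^{n_i}$$ is direct.
   Context: $\Gamma$ is the fundamental group of a closed (orientable) surface of genus at least $2$; its Gromov boundary $\partial_\infty\Gamma$ is homeomorphic to the circle. $E$ is a real vector space of dimension $d$, $\mathrm{Gr}_k(E)$ the Grassmannian of $k$-planes; $V\in\mathrm{Gr}_k(E)$, $W\in\mathrm{Gr}_{d-k}(E)$ are transverse if $V\oplus W=E$. Anosov: for $g\in\mathsf{PGL}(E)$ let $\lambda_1,\dots,\lambda_d$ be the generalized eigenvalues of a lift, counted with multiplicity, with non-increasing absolute values; $g$ is $k$-proximal if $|\lambda_k/\lambda_{k+1}(g)|>1$, equivalently if it has a unique attracting point in $\mathrm{Gr}_k(E)$. For $\gamma\in\Gamma$ of infinite order, $\gamma_+\in\partial_\infty\Gamma$ is its attracting fixed point. Fix a word metric $|\cdot|_\Gamma$ and let $|\gamma|_\infty=\lim_m|\gamma^m|_\Gamma/m$. $\rho:\Gamma\to\mathsf{PGL}(E)$ is $k$-Anosov ($1\le k\le d-1$) if there are $\rho$-equivariant continuous maps $\xi^k:\partial_\infty\Gamma\to\mathrm{Gr}_k(E)$, $\xi^{d-k}:\partial_\infty\Gamma\to\mathrm{Gr}_{d-k}(E)$ such that (i) $\xi^k(x)$ and $\xi^{d-k}(y)$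 are transverse for all $x\ne y$; (ii) for $j\in\{k,d-k\}$ and every infinite order $\gamma$, $\rho(\gamma)$ is $j$-proximal with attracting point $\xi^j(\gamma_+)$; (iii) $|\lambda_k/\lambda_{k+1}(\rho(\gamma_i))|\to\infty$ whenever $|\gamma_i|_\infty\to\infty$. $k$-Anosov is equivalent to $(d-k)$-Anosov. $\{1,\dots,k\}$-Anosov means $j$-Anosov for all $j=1,\dots,k$. Write $x^j=\xi^j(x)$, $x^0=\{0\}$, $x^d=E$. Positive flags: let $F$ be a real vector space of dimension $m\ge2$ with basis $(e_1,\dots,e_m)$ and $\mathcal F(F)$ the space of full flags. Let $\mathsf X,\mathsf Z\in\mathcal F(F)$ be given by $\mathsf X^j=\langle e_m,\dots,e_{m-j+1}\rangle$, $\mathsf Z^j=\langle e_1,\dots,e_j\rangle$. Let $U$ be the group of upper triangular matrices with ones on the diagonal, and $U^{>0}\subset U$ the subset of matrices all of whose minors that do not vanish identically on $U$ are positive. An $n$-tuple $(x_1,\dots,x_n)\in\mathcal F(F)^n$ ($n\ge3$) is positive if there are $g\in\mathsf{PGL}(F)$ and $P_2,\dots,P_{n-1}\in U^{>0}$ with $(gx_1,\dots,gx_n)=(\mathsf X,P_2\mathsf X,P_2P_3\mathsf X,\dots,P_2\cdots P_{n-1}\mathsf X,\mathsf Z)$. A map $\xi:I\subset\mathbb S^1\to\mathcal F(F)$ is positive if it sends every positively oriented $n$-tuple of points of $I$ to a positive $n$-tuple. $k$-positive: for $\rho$ $\{1,\dots,k\}$-Anosov and $x\in\partial_\infty\Gamma$,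 put $X=E/x^{d-k}$, with $[\cdot]_X$ the projection to $X$, and define $\pi_{[x]}:\partial_\infty\Gamma\setminus\{x\}\to\mathcal F(X)$, $\pi_{[x]}(y)=([y^1]_X,\dots,[y^{k-1}]_X)$, and $\pi_x:\partial_\infty\Gamma\setminus\{x\}\to\mathcal F(x^k)$, $\pi_x(y)=(y^{d-k+1}\cap x^k,\dots,y^{d-1}\cap x^k)$. For $k\ge2$, $\rho$ is $k$-positive if it is $\{1,\dots,k\}$-Anosov and for every $x\in\partial_\infty\Gamma$ both $\pi_{[x]}$ and $\pi_x$ are positive. $\rho$ is $1$-positive if it is $1$-Anosov. *)

(* Defs.v *)
From HB Require Import structures.
From mathcomp Require Import all_boot all_order all_algebra.
From mathcomp Require Import complex.
From mathcomp Require Import all_classical all_reals all_analysis.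
From mathcomp Require Import lra.

Set Implicit Arguments.
Unset Strict Implicit.
Unset Printing Implicit Defensive.

Import Order.TTheory GRing.Theory Num.Theory.
Import numFieldNormedType.Exports.

Local Open Scope classical_set_scope.
Local Open Scope quotient_scope.
Local Open Scope ring_scope.

Definition attracting_fixed_point (T : topologicalType) (f : T -> T) (p : T) :=
  f p = p /\
  exists2 U, nbhs p U &
    forall V, nbhs p V -> \forall n \near \oo, iter n f @` U `<=` V.

(* The group presented by < a_1, b_1, ..., a_g, b_g | [a_1, b_1] ... [a_g, b_g] >,
   i.e. the fundamental group of the closed orientable surface of genus g >= 2,
   is characterised up to isomorphism by its universal property. *)
Definition surface_relator (G : groupType) (g : nat) (a b : 'I_g -> G) : G :=
  (\big[*%g/1]_(i < g) (a i * b i * (a i)^-1 * (b i)^-1))%g.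

Definition surface_group (G : groupType) : Prop :=
  exists (g : nat) (a b : 'I_g -> G),
    [/\ (2 <= g)%N, surface_relator a b = 1%g &
      forall (H : groupType) (a' b' : 'I_g -> H), surface_relator a' b' = 1%g ->
        exists! f : G -> H,
          [/\ {morph f : x y / (x * y)%g},
              forall i, f (a i) = a' i & forall i, f (b i) = b' i]].

Section WordMetric.
Variables (G : groupType) (S : seq G).

Definition expressible (n : nat) (x : G) : Prop :=
  exists w : seq G,
    [/\ size w = n, all [pred s | (s \in S) || (s^-1%g \in S)] w
      & (\big[*%g/1]_(s <- w) s)%g = x].

Definition generates : Prop := forall x, exists n, expressible n x.

Definition word_length (x : G) : nat :=
  match pselect (exists n, `[< expressible n x >]) with
  | left ex => ex_minn ex
  | right _ => 0
  end.

Definition gromov_product (x y : G) : rat :=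
  ((word_length x)%:R + (word_length y)%:R - (word_length (x^-1 * y)%g)%:R) / 2.

Lemma word_length_expressible x :
  generates -> expressible (word_length x) x.
Proof.
move=> gen; rewrite /word_length; case: pselect => [ex|nex].
  by case: ex_minnP => n /asboolP.
by exfalso; apply: nex; have [n Hn] := gen x; exists n; apply/asboolP.
Qed.

Lemma word_length_le x n : expressible n x -> (word_length x <= n)%N.
Proof.
move=> Hn; rewrite /word_length; case: pselect => [ex|//].
case: ex_minnP => m _ min_m; apply: min_m; exact/asboolP.
Qed.

Lemma word_lengthM x y : generates ->
  (word_length (x * y)%g <= word_length x + word_length y)%N.
Proof.
move=> gen; apply: word_length_le.
have [w [sw aw defx]] := word_length_expressible x gen.
have [v [sv av defy]] := word_length_expressible y gen.
exists (w ++ v); split; first by rewrite size_cat sw sv.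
  by rewrite all_cat aw av.
by rewrite big_cat /= defx defy.
Qed.

Lemma word_lengthV_le x : generates ->
  (word_length x^-1%g <= word_length x)%N.
Proof.
move=> gen; apply: word_length_le.
have [w [sw aw defx]] := word_length_expressible x gen.
exists (rev [seq s^-1%g | s <- w]); split; first by rewrite size_rev size_map sw.
  rewrite all_rev all_map; apply: sub_all aw => s /=.
  by rewrite invgK orbC.
rewrite -[in RHS]defx; elim: w {sw aw defx} => [|s w IHw].
  by rewrite !big_nil invg1.
by rewrite /= rev_cons -cats1 big_cat IHw /= big_cons big_nil mulg1 big_cons invgM.
Qed.

Lemma word_lengthV x : generates -> word_length x^-1%g = word_length x.
Proof.
move=> gen; apply/eqP; rewrite eqn_leq word_lengthV_le //=.
by rewrite -{1}[x]invgK word_lengthV_le.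
Qed.

Lemma gromov_productC x y : generates ->
  gromov_product x y = gromov_product y x.
Proof.
move=> gen; rewrite /gromov_product -[(x^-1 * y)%g]invgK word_lengthV //.
by rewrite invgM invgK [(word_length x)%:R + _]addrC.
Qed.

End WordMetric.

(* A word-hyperbolic group with a fixed word metric: the Gromov boundary makes
   sense only for such groups.  Surface groups of genus at least 2 are hyperbolic
   for every finite generating family, so this imposes no restriction on them. *)
Record hyperbolicGroup := HyperbolicGroup {
  hyp_group :> groupType;
  hyp_gens : seq hyp_group;
  hyp_generates : generates hyp_gens;
  hyp_slim : exists delta : rat, forall x y z : hyp_group,
    Num.min (gromov_product hyp_gens x y) (gromov_product hyp_gens y z) - delta
      <= gromov_product hyp_gens x z
}.

Section GromovBoundary.
Variable G : hyperbolicGroup.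

Local Notation len := (word_length (hyp_gens G)).
Local Notation gp := (gromov_product (hyp_gens G)).

Definition eventually_ge (r : rat) (u v : nat -> G) : Prop :=
  exists N, forall m n, (N <= m)%N -> (N <= n)%N -> r <= gp (u m) (v n).

(* [fellow u u] says that u converges at infinity. *)
Definition fellow (u v : nat -> G) : Prop := forall r, eventually_ge r u v.

Definition gseq := {u : nat -> G | `[< fellow u u >]}.

Definition gseq_equiv (u v : gseq) : bool := `[< fellow (val u) (val v) >].

Lemma gseq_equiv_refl : reflexive gseq_equiv.
Proof. by move=> u; exact: (valP u). Qed.

Lemma fellow_sym u v : fellow u v -> fellow v u.
Proof.
move=> uv r; have [N HN] := uv r; exists N => m n mN nN.
by rewrite gromov_productC ?HN //; exact: hyp_generates.
Qed.

Lemma gseq_equiv_sym : symmetric gseq_equiv.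
Proof. by move=> u v; apply/asboolP/asboolP => /fellow_sym. Qed.

Lemma gseq_equiv_trans : transitive gseq_equiv.
Proof.
move=> v u w /asboolP uv /asboolP vw; apply/asboolP => r.
have [delta Hd] := hyp_slim G.
have [N1 H1] := uv (r + delta); have [N2 H2] := vw (r + delta).
exists (maxn N1 N2) => m n; rewrite !geq_max => /andP[m1 m2] /andP[n1 n2].
apply: le_trans (Hd _ (val v (maxn N1 N2)) _).
rewrite lerBrDr le_min H1 ?leq_maxl //= H2 ?leq_maxr //.
Qed.

Canonical gseq_equiv_rel :=
  EquivRel gseq_equiv gseq_equiv_refl gseq_equiv_sym gseq_equiv_trans.

Definition boundary := {eq_quot gseq_equiv}.
HB.instance Definition _ : EqQuotient _ gseq_equiv boundary :=
  EqQuotient.on boundary.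
HB.instance Definition _ := Choice.on boundary.

(* The sets [shadow x r] form a neighbourhood basis at x; they need not be open
   themselves. *)
Definition shadow (x : boundary) (r : rat) : set boundary :=
  [set y | exists u v : gseq,
    [/\ \pi_boundary u = x, \pi_boundary v = y
      & eventually_ge r (val u) (val v)]].

Definition boundary_open (U : set boundary) : Prop :=
  forall x, U x -> exists r, shadow x r `<=` U.

Lemma shadow_sub x r s : r <= s -> shadow x s `<=` shadow x r.
Proof.
move=> rs y [u [v [ux vy [N HN]]]]; exists u, v; split => //.
by exists N => m n mN nN; apply: le_trans (HN _ _ mN nN).
Qed.

Lemma boundary_openT : boundary_open setT.
Proof. by move=> x _; exists 0. Qed.

Lemma boundary_openI : setI_closed boundary_open.
Proof.
move=> U V oU oV x [/oU[r rU] /oV[s sV]]; exists (Num.max r s) => y Hy.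
by split; [apply: rU | apply: sV]; apply: shadow_sub Hy; rewrite le_max lexx ?orbT.
Qed.

Lemma boundary_open_bigU (I : Type) (f : I -> set boundary) :
  (forall i, boundary_open (f i)) -> boundary_open (\bigcup_i f i).
Proof.
move=> of_ x [i _ /of_[r rf]]; exists r => y /rf fy.
by exists i.
Qed.

HB.instance Definition _ :=
  isOpenTopological.Build boundary boundary_openT boundary_openI boundary_open_bigU.

Lemma fellow_translate (g : G) u v :
  fellow u v -> fellow (fun n => g * u n)%g (fun n => g * v n)%g.
Proof.
move=> uv r; have [N HN] := uv (r + (len g)%:R).
exists N => m n mN nN; have := HN _ _ mN nN; rewrite /gromov_product.
have -> : ((g * u m)^-1 * (g * v n) = (u m)^-1 * v n)%g.
  by rewrite invgM mulgA -(mulgA (u m)^-1%g) mulVg mulg1.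
have H w : (len w)%:R <= (len g)%:R + (len (g * w)%g)%:R :> rat.
  rewrite -natrD ler_nat -[w in leqLHS](mulKg g) -(word_lengthV g).
    exact/word_lengthM/hyp_generates.
  exact: hyp_generates.
have := H (u m); have := H (v n); lra.
Qed.

Definition translate (g : G) (u : gseq) : gseq :=
  exist _ (fun n => g * val u n)%g
    (asboolT (fellow_translate g (asboolW (valP u)))).

Definition boundary_act (g : G) (x : boundary) : boundary :=
  \pi_boundary (translate g (repr x)).

Lemma boundary_actE g u : boundary_act g (\pi u) = \pi_boundary (translate g u).
Proof.
have /eqmodP/asboolP uu := reprK (\pi_boundary u).
by apply/eqmodP/asboolP; exact: fellow_translate.
Qed.

Definition infinite_order (g : G) : Prop :=
  forall n, (0 < n)%N -> (g ^+ n)%g <> 1%g.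

Definition stable_length (R : realType) (g : G) : R :=
  lim (((len (g ^+ m)%g)%:R / m%:R : R) @[m --> \oo]).

End GromovBoundary.

Section ProjectiveGroup.
Variables (R : realType) (E : vectType R).

Definition GL := {f : 'End(E) | lker f == 0%VS}.
HB.instance Definition _ := Choice.on GL.

Lemma GL_mul_subproof (f g : GL) : lker (val f \o val g)%VF == 0%VS.
Proof.
apply/lker0P => u v; rewrite !comp_lfunE.
by move=> /(lker0P (valP f)) /(lker0P (valP g)).
Qed.

Lemma GL_one_subproof : lker (\1%VF : 'End(E)) == 0%VS.
Proof. by apply/lker0P => u v; rewrite !id_lfunE. Qed.

Lemma GL_inv_subproof (f : GL) : lker ((val f)^-1)%VF == 0%VS.
Proof. by apply/lker0P/(can_inj (lker0_lfunVK (valP f))). Qed.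

Definition GL_mul (f g : GL) : GL := exist (fun h : 'End(E) => lker h == 0%VS) _ (GL_mul_subproof f g).
Definition GL_one : GL :=
  exist (fun h : 'End(E) => lker h == 0%VS) _ GL_one_subproof.
Definition GL_inv (f : GL) : GL := exist (fun h : 'End(E) => lker h == 0%VS) _ (GL_inv_subproof f).

Lemma GL_mulA : associative GL_mul.
Proof. by move=> f g h; apply: val_inj; rewrite /= comp_lfunA. Qed.
Lemma GL_mul1 : left_id GL_one GL_mul.
Proof. by move=> f; apply: val_inj; rewrite /= comp_lfun1l. Qed.
Lemma GL_1mul : right_id GL_one GL_mul.
Proof. by move=> f; apply: val_inj; rewrite /= comp_lfun1r. Qed.
Lemma GL_mulV : left_inverse GL_one GL_inv GL_mul.
Proof. by move=> f; apply: val_inj; rewrite /= lker0_compVf // (valP f). Qed.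
Lemma GL_Vmul : right_inverse GL_one GL_inv GL_mul.
Proof. by move=> f; apply: val_inj; rewrite /= lker0_compfV // (valP f). Qed.

HB.instance Definition _ :=
  isGroup.Build GL GL_mulA GL_mul1 GL_1mul GL_mulV GL_Vmul.

Definition homothetic (f g : GL) : bool :=
  `[< exists2 c : R, c != 0 & val f = c *: val g >].

Lemma homothetic_refl : reflexive homothetic.
Proof. by move=> f; apply/asboolP; exists 1; rewrite ?oner_eq0 ?scale1r. Qed.

Lemma homothetic_symP f g : homothetic f g -> homothetic g f.
Proof.
move=> /asboolP[c c0 fg]; apply/asboolP; exists c^-1; rewrite ?invr_eq0 //.
by rewrite fg scalerA mulVf // scale1r.
Qed.

Lemma homothetic_sym : symmetric homothetic.
Proof. by move=> f g; apply/idP/idP => /homothetic_symP. Qed.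

Lemma homothetic_trans : transitive homothetic.
Proof.
move=> g f h /asboolP[c c0 fg] /asboolP[e e0 gh]; apply/asboolP.
by exists (c * e); rewrite ?mulf_neq0 // fg gh scalerA.
Qed.

Canonical homothetic_rel :=
  EquivRel homothetic homothetic_refl homothetic_sym homothetic_trans.

Definition PGL := {eq_quot homothetic}.
HB.instance Definition _ : EqQuotient _ homothetic PGL := EqQuotient.on PGL.
HB.instance Definition _ := Choice.on PGL.

Definition PGL_mul (x y : PGL) : PGL := \pi_PGL (repr x * repr y)%g.
Definition PGL_one : PGL := \pi_PGL 1%g.
Definition PGL_inv (x : PGL) : PGL := \pi_PGL (repr x)^-1%g.

Lemma homothetic_repr (f : GL) : homothetic (repr (\pi_PGL f)) f.
Proof. by apply/eqmodP; rewrite reprK. Qed.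

Lemma homotheticM f f' g g' :
  homothetic f f' -> homothetic g g' -> homothetic (f * g)%g (f' * g')%g.
Proof.
move=> /asboolP[c c0 ff] /asboolP[e e0 gg]; apply/asboolP.
exists (c * e); first by rewrite mulf_neq0.
apply/lfunP => u.
by rewrite /= ff gg !(comp_lfunE, scale_lfunE) linearZ scalerA.
Qed.

Lemma PGL_piM f g : \pi_PGL (f * g)%g = PGL_mul (\pi f) (\pi g).
Proof.
apply/eqmodP; apply: homotheticM; apply: homothetic_symP.
  exact: homothetic_repr.
exact: homothetic_repr.
Qed.

Lemma PGL_mulA : associative PGL_mul.
Proof.
elim/quotP => f _; elim/quotP => g _; elim/quotP => h _.
by rewrite -(PGL_piM g h) -(PGL_piM f (g * h)%g) -(PGL_piM f g)
  -(PGL_piM (f * g)%g h) mulgA.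
Qed.
Lemma PGL_mul1 : left_id PGL_one PGL_mul.
Proof. by elim/quotP => f _; rewrite -PGL_piM mul1g. Qed.
Lemma PGL_1mul : right_id PGL_one PGL_mul.
Proof. by elim/quotP => f _; rewrite -PGL_piM mulg1. Qed.
Lemma PGL_mulV : left_inverse PGL_one PGL_inv PGL_mul.
Proof. by elim/quotP => f Hf; rewrite /PGL_inv Hf -PGL_piM mulVg. Qed.
Lemma PGL_Vmul : right_inverse PGL_one PGL_inv PGL_mul.
Proof. by elim/quotP => f Hf; rewrite /PGL_inv Hf -PGL_piM mulgV. Qed.

HB.instance Definition _ :=
  isGroup.Build PGL PGL_mulA PGL_mul1 PGL_1mul PGL_mulV PGL_Vmul.

Definition PGL_lift (x : PGL) : 'End(E) := val (repr x).

Definition complex_char_poly (f : 'End(E)) : {poly R[i]} :=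
  map_poly (real_complex R)
    (char_poly (passmx.mxof (vbasis fullv) (vbasis fullv) f)).

Definition eigenvalues (f : 'End(E)) : seq R[i] :=
  sval (closed_field_poly_normal (complex_char_poly f)).

Definition eigen_moduli (f : 'End(E)) : seq R :=
  sort >=%R [seq Normc.normc z | z <- eigenvalues f].

(* |lambda_k / lambda_(k+1)|, the sequence of moduli being indexed from 0. *)
Definition eigen_gap (k : nat) (x : PGL) : R :=
  (eigen_moduli (PGL_lift x))`_k.-1 / (eigen_moduli (PGL_lift x))`_k.

Definition proximal (k : nat) (x : PGL) : Prop := 1 < eigen_gap k x.

End ProjectiveGroup.

Section Grassmannian.
Variables (R : realType) (E : vectType R).

(* The type of all subspaces of E, topologised as the disjoint union over k of
   the Grassmannians Gr_k(E), each of which carries the quotient topology from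
   the space of k x d matrices of rank k. *)
Definition Grass := {vspace E}.
HB.instance Definition _ := Choice.on Grass.

Definition row_span (k : nat) (M : 'M[R]_(k, \dim {:E})) : Grass :=
  <<[seq passmx.vecof (vbasis fullv) (row i M) | i : 'I_k]>>%VS.

Definition Grass_open (A : set Grass) : Prop :=
  forall k (M : 'M[R]_(k, \dim {:E})), row_free M -> A (row_span M) ->
    \forall N \near M, row_free N -> A (row_span N).

Lemma Grass_openT : Grass_open setT.
Proof. by move=> k M _ _; apply: filterE. Qed.

Lemma Grass_openI : setI_closed Grass_open.
Proof.
move=> A B oA oB k M fM [AM BM].
move: (oA k M fM AM) (oB k M fM BM); apply: filterS2 => N AN BN fN.
by split; [exact: AN | exact: BN].
Qed.

Lemma Grass_open_bigU (I : Type) (f : I -> set Grass) :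
  (forall i, Grass_open (f i)) -> Grass_open (\bigcup_i f i).
Proof.
move=> of_ k M fM [i _ fiM].
by move: (of_ i k M fM fiM); apply: filterS => N fN rN; exists i => //; exact: fN.
Qed.

HB.instance Definition _ :=
  isOpenTopological.Build Grass Grass_openT Grass_openI Grass_open_bigU.

Definition PGL_act (x : PGL E) (V : Grass) : Grass := (PGL_lift x @: V)%VS.

Lemma PGL_actE (f : GL E) (V : Grass) :
  PGL_act (\pi_(PGL E) f) V = (val f @: V)%VS.
Proof.
have /asboolP[c c0 cf] := homothetic_repr f.
rewrite /PGL_act /PGL_lift cf; apply/vspaceP => v; apply/memv_imgP/memv_imgP.
  by move=> [u uV ->]; exists (c *: u); rewrite ?memvZ // scale_lfunE linearZ.
move=> [u uV ->]; exists (c^-1 *: u); rewrite ?memvZ //.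
by rewrite scale_lfunE linearZ scalerA divff // scale1r.
Qed.

Definition transverse (V W : {vspace E}) : Prop :=
  (V :&: W)%VS = 0%VS /\ (V + W)%VS = fullv.

End Grassmannian.
(* The quotient E / U is realised on the complement U^C, with the projection
   along U as quotient map. *)
Section Quotient.
Variables (R : realType) (E : vectType R) (U : {vspace E}).

Definition quot_space := subvs_of (U^C)%VS.

Definition quot_proj : 'Hom(E, quot_space) :=
  linfun (vsproj (U^C)%VS \o daddv_pi (U^C)%VS U).

Lemma quot_proj_ker : lker quot_proj = U.
Proof.
apply/vspaceP => v; rewrite memv_ker lfunE /=.
have dUC : (U^C :&: U = 0)%VS by rewrite capvC capv_compl.
have dU : (U :&: U^C = 0)%VS by rewrite capv_compl.
have -> : (vsproj (U^C)%VS (daddv_pi (U^C)%VS U v) == 0)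
    = (daddv_pi (U^C)%VS U v == 0).
  by rewrite -(inj_eq val_inj) /= vsprojK // memv_pi.
have vUC : v \in (U + U^C)%VS by rewrite addv_complf memvf.
rewrite -{2}(daddv_pi_add dU vUC).
apply/eqP/idP => [->|]; first by rewrite addr0 memv_pi.
rewrite rpredDl ?memv_pi // => vU.
apply/eqP; rewrite -memv0 -dU memv_cap vU; exact: memv_pi.
Qed.

Lemma quot_proj_img : limg quot_proj = fullv.
Proof.
apply/vspaceP => w; rewrite memvf; apply/memv_imgP; exists (val w).
  exact: memvf.
rewrite lfunE /= daddv_pi_id ?vsvalK ?subvsP //.
by rewrite capvC capv_compl.
Qed.

End Quotient.

Section PositiveFlags.
Variables (R : realType) (F : vectType R).

Local Notation m := (\dim {:F}).
Local Notation e := (vbasis {:F}).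

(* A full flag x^1 < ... < x^(m-1) of F is encoded by a function of which only
   the values at 1, ..., m-1 are relevant. *)
Definition full_flag (x : nat -> {vspace F}) : Prop :=
  (forall j, (0 < j < m)%N -> \dim (x j) = j) /\
  (forall j l, (0 < j)%N -> (j <= l)%N -> (l < m)%N -> (x j <= x l)%VS).

Definition flag_X (j : nat) : {vspace F} := <<drop (m - j) e>>%VS.
Definition flag_Z (j : nat) : {vspace F} := <<take j e>>%VS.

Definition upper_unipotent (P : 'M[R]_m) : Prop :=
  forall i j : 'I_m, (j <= i)%N -> P i j = (i == j)%:R.

Definition increasing (r n : nat) (f : 'I_r -> 'I_n) : Prop :=
  forall i j : 'I_r, (i < j)%N -> (f i < f j)%N.

Definition totally_positive (P : 'M[R]_m) : Prop :=
  upper_unipotent P /\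
  forall (r : nat) (f g : 'I_r -> 'I_m), increasing f -> increasing g ->
    (exists2 Q : 'M[R]_m, upper_unipotent Q & \det (mxsub f g Q) != 0) ->
    0 < \det (mxsub f g P).

(* Matrices act on column vectors of coordinates in the basis e, whereas
   [passmx.hommx] acts on row vectors. *)
Definition mx_endo (P : 'M[R]_m) : 'End(F) := passmx.hommx e e P^T.

(* Since g ranges over PGL(F), the choice of the basis e is immaterial. *)
Definition positive_tuple (n : nat) (x : 'I_n -> nat -> {vspace F}) : Prop :=
  (forall i, full_flag (x i)) /\
  exists (g : PGL F) (P : nat -> 'M[R]_m),
    (forall l, (l < n - 2)%N -> totally_positive (P l)) /\
    forall (i : 'I_n) (j : nat), (0 < j < m)%N ->
      PGL_act g (x i j) =
        if i.+1 == n then flag_Z j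
        else (mx_endo (\big[mulmx/1%:M]_(0 <= l < i) P l) @: flag_X j)%VS.

End PositiveFlags.

Section Circle.
Variables (R : realType) (T : topologicalType).

Definition unit_circle : set (R * R) := [set z | z.1 ^+ 2 + z.2 ^+ 2 = 1].

Definition homeo_circle (phi : T -> R * R) : Prop :=
  [/\ continuous phi, range phi = unit_circle &
    exists2 psi : R * R -> T,
      cancel phi psi & {within unit_circle, continuous psi}].

Definition positively_oriented (phi : T -> R * R) (n : nat) (p : 'I_n -> T) :=
  exists theta : 'I_n -> R,
    [/\ forall i, phi (p i) = (cos (theta i), sin (theta i)),
        forall i j : 'I_n, (i < j)%N -> theta i < theta j &
        forall i j, theta j < theta i + 2 * pi].

Definition positive_map (phi : T -> R * R) (I : set T) (F : vectType R)
    (xi : T -> nat -> {vspace F}) : Prop :=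
  forall (n : nat) (p : 'I_n -> T), (3 <= n)%N -> (forall i, I (p i)) ->
    positively_oriented phi p -> positive_tuple (fun i => xi (p i)).

End Circle.

Section Anosov.
Variables (R : realType) (G : hyperbolicGroup) (E : vectType R).
Variable rho : {multiplicative G -> PGL E}.

Local Notation d := (\dim {:E}).

Definition equivariant (f : boundary G -> Grass E) : Prop :=
  forall g x, f (boundary_act g x) = PGL_act (rho g) (f x).

Definition dynamics_preserving (j : nat) (f : boundary G -> Grass E) : Prop :=
  forall g : G, infinite_order g ->
    proximal j (rho g) /\
    exists2 x, attracting_fixed_point (boundary_act g) x &
      attracting_fixed_point (PGL_act (rho g)) (f x).

(* rho is k-Anosov, with limit maps f to Gr_k(E) and h to Gr_(d-k)(E). *)
Record anosov_maps (k : nat) (f h : boundary G -> Grass E) : Prop := AnosovMaps {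
  anosov_range : (0 < k < d)%N;
  anosov_dim : forall x, \dim (f x) = k;
  anosov_codim : forall x, \dim (h x) = (d - k)%N;
  anosov_equivariant : equivariant f /\ equivariant h;
  anosov_continuous : continuous f /\ continuous h;
  anosov_transverse : forall x y, x <> y -> transverse (f x) (h y);
  anosov_dynamics : dynamics_preserving k f /\ dynamics_preserving (d - k) h;
  anosov_gap : forall u : nat -> G,
    (stable_length R (u i) @[i --> \oo] --> +oo) ->
    (eigen_gap k (rho (u i)) @[i --> \oo] --> +oo)
}.

Definition anosov (k : nat) : Prop := exists f h, anosov_maps k f h.

(* The limit maps x |-> x^j = xi j x of a {1, ..., k}-Anosov representation, for
   j = 0, ..., k, d - k, ..., d; the other values of xi are irrelevant. *)
Definition limit_maps (k : nat) (xi : nat -> boundary G -> Grass E) : Prop :=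
  [/\ forall j, (0 < j <= k)%N -> anosov_maps j (xi j) (xi (d - j)%N),
      forall x, xi 0 x = 0%VS & forall x, xi d x = fullv].

Section Projections.
Variables (k : nat) (xi : nat -> boundary G -> Grass E) (x : boundary G).

Definition pi_quot (y : boundary G) (j : nat)
    : {vspace quot_space (xi (d - k)%N x)} :=
  (quot_proj (xi (d - k)%N x) @: xi j y)%VS.

(* The preimage of x^k under the inclusion vsval is the intersection with x^k. *)
Definition pi_sub (y : boundary G) (j : nat) : {vspace subvs_of (xi k x)} :=
  (linfun (@vsval _ _ (xi k x)) @^-1: xi (d - k + j)%N y)%VS.

End Projections.

Definition k_positive (phi : boundary G -> R * R) (k : nat) : Prop :=
  [/\ (0 < k)%N, forall j, (0 < j <= k)%N -> anosov j &
    (2 <= k)%N -> forall xi, limit_maps k xi -> forall x,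
      positive_map phi [set~ x] (pi_quot k xi x) /\
      positive_map phi [set~ x] (pi_sub k xi x)].

End Anosov.

(* Main.v *)
Require Import Defs.
From HB Require Import structures.
From mathcomp Require Import all_boot all_order all_algebra.
From mathcomp Require Import fingroup perm.
From mathcomp Require Import all_classical all_reals all_analysis.
From mathcomp Require Import zify ring lra.

Set Implicit Arguments.
Unset Strict Implicit.
Unset Printing Implicit Defensive.

Import Order.TTheory GRing.Theory Num.Theory.
Import numFieldNormedType.Exports.

Local Open Scope classical_set_scope.
Local Open Scope quotient_scope.
Local Open Scope ring_scope.

(** Let d be the dimension of E, let x = x_i be the last point, write its
    multiplicity as n_i = d - k' with k' <= k, and let Y be the sum of the
    other spaces.  After adding one more boundary point the other multiplicities
    add up to exactly k', and directness becomes the equality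
    Y + x^(d-k') = E.

    For k' = k this is general position of a positive tuple of flags in the
    quotient E / x^(d-k) ([span_at_codim_k]).  In suitable coordinates the spaces
    of such a tuple form a nested expression
    X^n1 + P1 (X^n2 + P2 (X^n3 + ... )) with totally positive matrices, whose
    Pluecker coordinates stay nonnegative by the Cauchy-Binet formula, the
    relevant one being positive ([nested_span_basis], [positive_tuple_span]).

    For k' < k put c = k - k'.  Positivity is given in E / x^(d-k), and the link
    between x^(d-k) and x^(d-k') is that the latter is a limit of spaces
    t^c + p^(d-k) with p and t tending to x ([approximation]).  A limit of
    nonzero determinants may vanish, so an inequality that survives the limit is
    needed.  For points in the cyclic order t, s, y_1, ..., y_m, with
    Y = y_1^(n_1) + ... + y_m^(n_m) and Z = y_m^(k'), positivity in E / p^(d-k)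
    gives
    |det(Y,s^c)| |det(Z,t^c)| <= |det(Y,t^c)| |det(Z,s^c)|
    ([positive_tuple_cross], [limit_cross_ratio]): a cross ratio is monotone
    along a positive curve.  The analogous inequality at the limit has a nonzero
    left-hand side, by the case k' = k at x and by transversality of y_m^(k')
    and x^(d-k'); hence det(Y, x^(d-k')) does not vanish ([span_at_codim]).

    The approximation comes from dynamics.  If p and q are distinct fixed points
    of g and p^(d-k') attracts for rho(g), every complement of the invariant
    space q^(k') is attracted to p^(d-k'): conjugating by the homothety that
    contracts q^(k') reduces this to the local statement
    ([attracting_complement]).  The space s^c + p^(d-k) is such a complement by
    the case k' = k.  Such p occur near every boundary point: the orbits of two
    distinct boundary points are dense together ([orbits_dense]), and the
    attracting points of g and of its inverse are distinct. *)

(** * Minors of products *)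

Section CauchyBinet.
Variable R : comNzRingType.

Lemma det_mulmx_expand n m (A : 'M[R]_(n, m)) (B : 'M[R]_(m, n)) :
  \det (A *m B) =
  \sum_(f : {ffun 'I_n -> 'I_m}) (\prod_i A i (f i)) * \det (rowsub f B).
Proof.
transitivity (\sum_(s : 'S_n) \sum_(f : {ffun 'I_n -> 'I_m})
   (-1) ^+ s * \prod_i (A i (f i) * B (f i) (s i))).
  apply: eq_bigr => s _; rewrite -big_distrr /=; congr (_ * _).
  rewrite -(bigA_distr_bigA (fun i j => A i j * B j (s i))) /=.
  by apply: eq_bigr => i _; rewrite mxE.
rewrite exchange_big /=; apply: eq_bigr => f _.
rewrite big_distrr /=; apply: eq_bigr => s _.
rewrite big_split /= mulrCA; congr (_ * (_ * _)).
by apply: eq_bigr => i _; rewrite mxE.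
Qed.

Lemma det_rowsub_perm n m (B : 'M[R]_(m, n)) (f : 'I_n -> 'I_m) (s : 'S_n) :
  \det (rowsub (f \o s) B) = (-1) ^+ s * \det (rowsub f B).
Proof.
by rewrite rowsub_comp -row_permEsub row_permE det_mulmx det_perm.
Qed.

Lemma det_colsub_perm n m (A : 'M[R]_(n, m)) (f : 'I_n -> 'I_m) (s : 'S_n) :
  \det (colsub (f \o s) A) = (-1) ^+ s * \det (colsub f A).
Proof.
rewrite -det_tr trmx_mxsub (det_rowsub_perm _ f) -[in RHS]det_tr trmx_mxsub.
by [].
Qed.

(** The sum runs over all maps instead of increasing ones, whence the factorial:
    a summand does not change when [f] is precomposed with a permutation, since
    both of its determinants are multiplied by the same sign. *)
Lemma cauchy_binet_sym n m (A : 'M[R]_(n, m)) (B : 'M[R]_(m, n)) :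
  \det (A *m B) *+ n`! =
  \sum_(f : {ffun 'I_n -> 'I_m}) \det (colsub f A) * \det (rowsub f B).
Proof.
(* Expand det(colsub f A) and substitute f o s for f: each s contributes the
   same amount, namely the full determinant of the product. *)
pose F (s : 'S_n) (f : {ffun 'I_n -> 'I_m}) :=
  (-1) ^+ s * \prod_i A i (f (s i)) * \det (rowsub f B).
transitivity (\sum_(s : 'S_n) \sum_f F s f); last first.
  rewrite exchange_big /=; apply: eq_bigr => f _.
  rewrite /F -big_distrl /=; congr (_ * _); apply: eq_bigr => s _; congr (_ * _).
  by apply: eq_bigr => i _; rewrite mxE.
rewrite -card_Sn -sumr_const; apply: eq_big => [s|s _]; first by rewrite inE.
rewrite det_mulmx_expand (reindex_inj (h := fun f : {ffun 'I_n -> 'I_m} =>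
   [ffun i => f (s i)])) /=; last first.
  move=> f g /ffunP fg; apply/ffunP => i.
  by move: (fg ((s^-1)%g i)); rewrite !ffunE permKV.
apply: eq_bigr => f _; rewrite /F.
have -> : rowsub [ffun i => f (s i)] B = rowsub (f \o s) B.
  by apply: eq_rowsub => i; rewrite ffunE.
rewrite det_rowsub_perm mulrCA mulrA; congr (_ * _ * _).
by apply: eq_bigr => i _; rewrite ffunE.
Qed.

Lemma det_colsub_ninj n m (A : 'M[R]_(n, m)) (f : 'I_n -> 'I_m) :
  ~ injective f -> \det (colsub f A) = 0.
Proof.
move=> ninj; have /injectivePn[i [j ij fij]] : ~~ injectiveb f.
  by apply/negP => /injectiveP.
rewrite -det_tr (determinant_alternate ij) // => l.
by rewrite !mxE fij.
Qed.

End CauchyBinet.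

(** The rank of [f i] among the values of [f] is a permutation; its inverse sorts
    [f]. *)
Lemma sort_injective r n (f : 'I_r -> 'I_n) : injective f ->
  exists s : 'S_r, increasing (f \o s).
Proof.
move=> injf; pose below i : {set 'I_r} := [set j | (f j < f i)%N]%SET.
have rk_lt i : (#|below i| < r)%N.
  rewrite -[X in (_ < X)%N](card_ord r) -cardsT; apply: proper_card.
  by rewrite properT; apply/eqP => /setP /(_ i); rewrite !inE ltnn.
have rk_mono i j : (f i < f j)%N -> (#|below i| < #|below j|)%N.
  move=> ij; apply/proper_card/properP; split.
    by apply/fintype.subsetP => l; rewrite !inE => /ltn_trans; apply.
  by exists i; rewrite !inE ?ltnn.
pose rk i := Ordinal (rk_lt i).
have rk_inj : injective rk.
  move=> i j [eq_rk]; apply/injf/val_inj.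
  by case: (ltngtP (f i) (f j)) => // /rk_mono; rewrite eq_rk ltnn.
exists ((perm rk_inj)^-1)%g => i j ij /=.
set a := _ i; set b := _ j.
have ra : rk a = i by rewrite -[RHS](permKV (perm rk_inj)) permE.
have rb : rk b = j by rewrite -[RHS](permKV (perm rk_inj)) permE.
case: (ltngtP (f a) (f b)) => // [/rk_mono|/val_inj/injf ab].
  move=> h; have : (rk b < rk a)%N by [].
  by rewrite ra rb ltnNge ltnW.
by move: ij; rewrite -ra -rb ab ltnn.
Qed.

Section Minors.
Variable R : realFieldType.

(** For a basis [H], the rows of which are wedged together, these are the
    Pluecker coordinates of the row space. *)
Definition nonneg_minors N m (H : 'M[R]_(N, m)) : Prop :=
  forall f : 'I_N -> 'I_m, increasing f -> 0 <= \det (colsub f H).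

(** Sorting [f] changes both determinants by the same sign. *)
Lemma minor_prod_ge0 N m (H : 'M[R]_(N, m)) (B : 'M[R]_(m, N)) :
  nonneg_minors H ->
  (forall f : 'I_N -> 'I_m, increasing f -> 0 <= \det (rowsub f B)) ->
  forall f : 'I_N -> 'I_m, 0 <= \det (colsub f H) * \det (rowsub f B).
Proof.
move=> pH pB f; case: (pselect (injective f)) => [injf|ninj]; last first.
  by rewrite det_colsub_ninj // mul0r.
have [s incs] := sort_injective injf.
suff -> : \det (colsub f H) * \det (rowsub f B)
        = \det (colsub (f \o s) H) * \det (rowsub (f \o s) B).
  by rewrite mulr_ge0 ?pH ?pB.
by rewrite det_colsub_perm det_rowsub_perm mulrACA -expr2 sqrr_sign mul1r.
Qed.

Lemma det_mulmx_ge0 N m (H : 'M[R]_(N, m)) (B : 'M[R]_(m, N)) :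
  nonneg_minors H ->
  (forall f : 'I_N -> 'I_m, increasing f -> 0 <= \det (rowsub f B)) ->
  0 <= \det (H *m B).
Proof.
move=> pH pB; rewrite -(pmulrn_lge0 _ (fact_gt0 N)) cauchy_binet_sym.
by apply: sumr_ge0 => f _; exact: minor_prod_ge0.
Qed.

Lemma det_mulmx_gt0 N m (H : 'M[R]_(N, m)) (B : 'M[R]_(m, N)) f0 :
  nonneg_minors H ->
  (forall f : 'I_N -> 'I_m, increasing f -> 0 <= \det (rowsub f B)) ->
  0 < \det (colsub f0 H) -> 0 < \det (rowsub f0 B) ->
  0 < \det (H *m B).
Proof.
move=> pH pB pH0 pB0; rewrite -(pmulrn_lgt0 _ (fact_gt0 N)) cauchy_binet_sym.
rewrite (bigD1 [ffun i => f0 i]) //= ltr_pwDl //; last first.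
  by apply: sumr_ge0 => f _; exact: minor_prod_ge0.
have -> : colsub [ffun i => f0 i] H = colsub f0 H.
  by apply: eq_colsub => i; rewrite ffunE.
have -> : rowsub [ffun i => f0 i] B = rowsub f0 B.
  by apply: eq_rowsub => i; rewrite ffunE.
exact: mulr_gt0.
Qed.

End Minors.

(** * Nonnegative minors and nested sums of flags *)

Lemma increasing_bound r n (f : 'I_r -> 'I_n) : increasing f ->
  forall i, (f i + r <= n + i)%N.
Proof.
move=> incf i; have [j] := ubnP (r - i); elim: j i => // j IHj i ij.
have [le_r|lt_r] := leqP r i.+1.
  by have := ltn_ord (f i); have := ltn_ord i; lia.
have := IHj (Ordinal lt_r) ltac:(rewrite /=; lia).
by have := incf i (Ordinal lt_r) (leqnn _) => /=; lia.
Qed.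

Lemma shift_ord_subproof N m s : (s + N <= m)%N -> forall i : 'I_N, (s + i < m)%N.
Proof. by move=> h i; have := ltn_ord i; lia. Qed.

Definition shift_ord N m s (h : (s + N <= m)%N) (i : 'I_N) : 'I_m :=
  Ordinal (shift_ord_subproof h i).

Lemma increasing_shift_ord N m s (h : (s + N <= m)%N) : increasing (shift_ord h).
Proof. by move=> i j /=; lia. Qed.

Section LastRows.
Variable R : realFieldType.

Definition last_rows n m : 'M[R]_(n, m) :=
  \matrix_(a, b) ((b : nat) == m - n + a)%N%:R.

Lemma last_rowsE s n : last_rows n (s + n) = row_mx 0 1%:M.
Proof.
apply/matrixP => a b; rewrite !mxE.
case: splitP => j -> /=; rewrite !mxE; last by rewrite addnK eqn_add2l eq_sym.
by have := ltn_ord j; case: eqP => //; lia.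
Qed.

(** Wedging with the last [n] basis vectors keeps only the Pluecker coordinates of
    [H] supported on the first [m - n] vectors, and keeps them without sign
    because the new vectors come last. *)
Lemma det_append_last N n m (H : 'M[R]_(N, m)) (f : 'I_(N + n) -> 'I_m) :
  (forall a, (f (rshift N a) : nat) = m - n + a)%N ->
  (forall b, f (lshift n b) < m - n)%N ->
  \det (colsub f (col_mx H (last_rows n m))) = \det (colsub (f \o @lshift N n) H).
Proof.
move=> fr fl; pose B := colsub (f \o @rshift N n) H.
transitivity (\det (block_mx (colsub (f \o @lshift N n) H) B 0 (1%:M : 'M[R]_n))).
  congr (\det _); apply/matrixP => a b; rewrite !mxE.
  case: (splitP a) => a' ea; rewrite !mxE; case: (splitP b) => b' eb; rewrite !mxE.
  - by congr (H _ (f _)); apply: val_inj.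
  - by congr (H _ (f _)); apply: val_inj.
  - have -> : b = lshift n b' by apply: val_inj.
    by have := fl b'; case: eqP => //; lia.
  - have -> : b = rshift N b' by apply: val_inj.
    by rewrite fr eqn_add2l eq_sym.
by rewrite det_ublock det1 mulr1.
Qed.

Lemma nonneg_minors_append N n m (H : 'M[R]_(N, m)) : (n <= m)%N ->
  nonneg_minors H -> nonneg_minors (col_mx H (last_rows n m)).
Proof.
move=> nm pH f incf.
have fle a : (f (rshift N a) <= m - n + a)%N.
  by have := increasing_bound incf (rshift N a) => /=; lia.
have [hit|/existsNP[a nhit]] := pselect (forall a : 'I_n, exists b,
    (f b : nat) = m - n + a)%N; last first.
  suff -> : \det (colsub f (col_mx H (last_rows n m))) = 0 by [].
  rewrite (expand_det_row _ (rshift N a)) big1 // => b _.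
  rewrite !mxE; case: splitP => a' /= ea; first by have := ltn_ord a'; lia.
  have -> : a' = a by apply: val_inj => /=; lia.
  rewrite !mxE; case: eqP => [e|]; last by rewrite mul0r.
  by exfalso; apply: nhit; exists b.
(* The columns hitting the last n basis vectors are the last n columns. *)
have [g gP] := choice hit.
have incg : increasing g.
  move=> a1 a2 a12; rewrite ltnNge leq_eqVlt; apply/negP => /orP[/eqP e|/incf].
    by have e' := val_inj e; have := gP a1; have := gP a2; rewrite e'; lia.
  by rewrite !gP; lia.
have fr a : (f (rshift N a) : nat) = (m - n + a)%N.
  apply/eqP; rewrite eqn_leq fle /= -gP.
  have ga : (g a <= rshift N a)%N.
    by have := increasing_bound incg a => /=; lia.
  move: ga; rewrite leq_eqVlt => /orP[/eqP/val_inj ->//|/incf]; exact: ltnW.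
have fl b : (f (lshift n b) < m - n)%N.
  case: (posnP n) => [n0|n0].
    by have := ltn_ord (f (lshift n b)); lia.
  have := incf (lshift n b) (rshift N (Ordinal n0)) => /=.
  by rewrite fr /= => /(_ ltac:(have := ltn_ord b; lia)); lia.
rewrite det_append_last //; apply: pH => i j ij; exact: incf.
Qed.

Lemma nonneg_minors_mul N m (H : 'M[R]_(N, m)) (P : 'M[R]_m) :
  (forall (r : nat) (f g : 'I_r -> 'I_m), increasing f -> increasing g ->
     0 <= \det (mxsub f g P)) ->
  nonneg_minors H -> nonneg_minors (H *m P^T).
Proof.
move=> pP pH f incf; rewrite -mulmx_colsub; apply: det_mulmx_ge0 => // h inch.
rewrite -det_tr trmx_mxsub trmx_mxsub trmxK.
rewrite -[X in \det X](_ : mxsub f h P = _) ?pP //.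
by apply/matrixP => i j; rewrite !mxE.
Qed.

(** The part of total positivity that general position and the cross ratio
    inequality rely on, stated without reference to unipotent matrices. *)
Definition shift_positive m (P : 'M[R]_m) : Prop :=
  (forall (r : nat) (f g : 'I_r -> 'I_m), increasing f -> increasing g ->
     0 <= \det (mxsub f g P)) /\
  forall N s t (hs : (s + N <= m)%N) (ht : (t + N <= m)%N), (s <= t)%N ->
    0 < \det (mxsub (shift_ord hs) (shift_ord ht) P).

(** For row vectors, this is the sum of the pieces X^(n_0), P_0 X^(n_1),
    P_0 P_1 X^(n_2), ... of flags in a positive tuple. *)
Fixpoint nested_span m (ns : seq nat) (P : nat -> 'M[R]_m) : 'M[R]_m :=
  if ns is n :: ns' then
    (last_rows n m + nested_span ns' (P \o succn) *m (P 0%N)^T)%MS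
  else 0.

(** Both steps of the nested construction, multiplication by a totally positive
    matrix and adding the last basis vectors, preserve nonnegativity of the
    Pluecker coordinates.  The coordinate on the last [N] vectors stays positive:
    before wedging it comes from an interval of rows shifted to the left, and the
    corresponding minor of [P] is positive. *)
Lemma nested_span_basis m ns (P : nat -> 'M[R]_m) : (sumn ns <= m)%N ->
  (forall l, (l.+1 < size ns)%N -> shift_positive (P l)) ->
  exists N (H : 'M[R]_(N, m)) (hN : (m - N + N <= m)%N),
    [/\ N = sumn ns, (H :=: nested_span ns P)%MS, nonneg_minors H
      & 0 < \det (colsub (shift_ord hN) H)].
Proof.
elim: ns P => [|n ns IHns] P /= le_m posP.
  have h0 : (m - 0 + 0 <= m)%N by lia.
  exists 0%N, 0, h0; split => //.
  - by apply/eqmxP; rewrite !sub0mx.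
  - by move=> f _; rewrite det_mx00.
  - by rewrite det_mx00.
have [||N [H [hN [eN eH pH posH]]]] := IHns (P \o succn); first by lia.
  by move=> l lt_l; apply: (posP l.+1).
have hNn : (m - (N + n) + (N + n) <= m)%N by lia.
have hN' : (m - (N + n) + N <= m)%N by lia.
have spanE : (col_mx (H *m (P 0%N)^T) (last_rows n m)
              :=: last_rows n m + nested_span ns (P \o succn) *m (P 0%N)^T)%MS.
  rewrite addsmxC; apply: eqmx_trans (eqmx_sym (addsmxE _ _)) _.
  by apply: adds_eqmx => //; exact: eqmxMr.
have fE : \det (colsub (shift_ord hNn) (col_mx (H *m (P 0%N)^T) (last_rows n m)))
    = \det (colsub (shift_ord hN') (H *m (P 0%N)^T)).
  rewrite det_append_last => [|a /=|b /=].
  - by congr (\det _); apply: eq_colsub => i; apply: val_inj.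
  - by lia.
  - by have := ltn_ord b; lia.
exists (N + n)%N, (col_mx (H *m (P 0%N)^T) (last_rows n m)), hNn.
split=> //; first by lia.
- apply: nonneg_minors_append; first by lia.
  have [ns0|ns0] := posnP (size ns).
    have N0 : N = 0%N by rewrite eN (size0nil ns0).
    by rewrite {eH posH hN eN hNn hN' spanE fE} => f _; move: H pH f; rewrite N0 => H _ f; rewrite det_mx00.
  by apply: nonneg_minors_mul => //; case: (posP 0%N).
- rewrite fE.
  have [ns0|ns0] := posnP (size ns).
    have N0 : N = 0%N by rewrite eN (size0nil ns0).
    by clear -N0; move: H hN'; rewrite N0 => H hN'; rewrite det_mx00.
  have [posP1 posP2] := posP 0%N ns0.
  rewrite -mulmx_colsub; apply: (det_mulmx_gt0 (f0 := shift_ord hN)) => //.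
    move=> h inch; rewrite -[X in \det X](_ : (mxsub (shift_ord hN') h (P 0%N))^T = _).
      by rewrite det_tr posP1 //; exact: increasing_shift_ord.
    by apply/matrixP => i j; rewrite !mxE.
  rewrite -[X in \det X](_ : (mxsub (shift_ord hN') (shift_ord hN) (P 0%N))^T = _).
    by rewrite det_tr posP2 //; lia.
  by apply/matrixP => i j; rewrite !mxE.
Qed.

End LastRows.

(** * Cross ratios of positive configurations *)

Section CrossRatio.
Variable R : realType.

Lemma pid_mx_rowE n s : (pid_mx n : 'M[R]_(n, n + s)) = row_mx 1%:M 0.
Proof. exact: pid_mx_row. Qed.

(** With the first [n] basis vectors, the determinant of the whole system is the
    last Pluecker coordinate of the nested span. *)
Lemma nested_span_full m ns n (P : nat -> 'M[R]_m) :
  (sumn ns + n)%N = m ->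
  (forall l, (l.+1 < size ns)%N -> shift_positive (P l)) ->
  row_full (nested_span ns P + (pid_mx n : 'M[R]_(n, m)))%MS.
Proof.
move=> def_m posP.
have [|N [H [hN [eN eH _ posH]]]] := @nested_span_basis R m ns P _ posP.
  by lia.
have def_m' : (n + N)%N = m by lia.
suff full : row_full (col_mx (pid_mx n : 'M[R]_(n, m)) H).
  rewrite /row_full addsmxC (adds_eqmx (eqmx_refl _) (eqmx_sym eH)).
  by rewrite addsmxE.
move: {P posP eN def_m eH ns} H hN posH; case: m / def_m' => H hN posH.
rewrite row_full_unit unitmxE unitfE -[H]hsubmxK pid_mx_rowE.
have -> : col_mx (row_mx 1%:M 0) (row_mx (lsubmx H) (rsubmx H))
   = block_mx 1%:M 0 (lsubmx H) (rsubmx H) by [].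
rewrite det_lblock det1 mul1r rsubmxEsub gt_eqF // (lt_le_trans posH) //.
rewrite le_eqVlt; apply/orP; left; apply/eqP; congr (\det _).
by apply: eq_colsub => i; apply: val_inj => /=; rewrite addnK.
Qed.

Lemma lsubmx_col_mx m1 m2 n1 n2 (A : 'M[R]_(m1, n1 + n2)) (B : 'M[R]_(m2, n1 + n2)) :
  lsubmx (col_mx A B) = col_mx (lsubmx A) (lsubmx B).
Proof. by apply/matrixP => i j; rewrite !mxE; case: splitP => k _; rewrite mxE. Qed.

Lemma rsubmx_col_mx m1 m2 n1 n2 (A : 'M[R]_(m1, n1 + n2)) (B : 'M[R]_(m2, n1 + n2)) :
  rsubmx (col_mx A B) = col_mx (rsubmx A) (rsubmx B).
Proof. by apply/matrixP => i j; rewrite !mxE; case: splitP => k _; rewrite mxE. Qed.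

Definition upper_unitriangular m (A : 'M[R]_m) : Prop :=
  forall i j : 'I_m, (j <= i)%N -> A i j = (i == j)%:R.

Lemma det_upper_unitriangular m (A : 'M[R]_m) : upper_unitriangular A -> \det A = 1.
Proof.
move=> uA; rewrite -det_tr det_trig.
  by rewrite big1 // => i _; rewrite mxE uA // eqxx.
apply/is_trig_mxP => i j ij; rewrite mxE uA ?(ltnW ij) //.
by rewrite -val_eqE gtn_eqF.
Qed.

(** Write det(Y, A Ec) and det(Y, Ec) by the Cauchy-Binet formula as sums of
    products of minors of [G] and of [A].  Subtracting rows of A Ec replaces [G]
    in the first determinant by its part on the first n + N columns, so that the
    first sum consists of some of the nonnegative terms of the second one. *)
Lemma det_cross_le n N c (A : 'M[R]_(n + N + c)) (G : 'M[R]_(N, n + N + c)) :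
  upper_unitriangular A ->
  (forall (r : nat) (f g : 'I_r -> 'I_(n + N + c)), increasing f -> increasing g ->
     0 <= \det (mxsub f g A)) ->
  nonneg_minors G ->
  0 <= \det (col_mx (col_mx (pid_mx n) (G *m A^T)) (last_rows R c _ *m A^T))
    <= \det (col_mx (col_mx (pid_mx n) (G *m A^T)) (last_rows R c _)).
Proof.
move=> uA pA pG; set Y := col_mx (pid_mx n) _; set Ec := last_rows _ _ _.
pose mid : 'I_N -> 'I_(n + N + c) := @lshift _ _ \o @rshift n N.
pose J : 'M[R]_(n + N + c) := block_mx 1%:M 0 0 0.
pose AT := A^T; pose a21 := dlsubmx AT.
have ur0 : ursubmx AT = 0.
  apply/matrixP => i j; rewrite !mxE uA /= ?leq_addr //; last first.
    by rewrite (leq_trans (ltnW (ltn_ord i))) ?leq_addr.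
  by rewrite eq_sym; case: eqP => // /(congr1 val) /=; have := ltn_ord i; lia.
have AblockE : AT = block_mx (ulsubmx AT) 0 a21 (drsubmx AT).
  by rewrite -ur0 submxK.
have pidE : (pid_mx n : 'M[R]_(n, n + N + c)) = row_mx (row_mx 1%:M 0) 0.
  apply/matrixP => i j; rewrite !mxE ltn_ord andbT.
  case: splitP => j' -> /=; rewrite !mxE; last first.
    by have := ltn_ord i; case: eqP => //; lia.
  case: splitP => j'' -> /=; rewrite !mxE //.
  by have := ltn_ord i; case: eqP => //; lia.
have middet (K : 'M[R]_(N, n + N + c)) :
    \det (col_mx (pid_mx n) (lsubmx K) : 'M[R]_(n + N)) = \det (colsub mid K).
  rewrite pid_mx_rowE -[lsubmx K]hsubmxK.
  have -> : col_mx (row_mx 1%:M 0) (row_mx (lsubmx (lsubmx K)) (rsubmx (lsubmx K)))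
   = block_mx 1%:M 0 (lsubmx (lsubmx K)) (rsubmx (lsubmx K)) by [].
  rewrite det_lblock det1 mul1r; congr (\det _).
  by apply/matrixP => i j; rewrite !mxE.
have pid_l : lsubmx (pid_mx n : 'M[R]_(n, n + N + c)) = pid_mx n.
  by rewrite pidE row_mxKl pid_mx_rowE.
have pid_r : rsubmx (pid_mx n : 'M[R]_(n, n + N + c)) = 0.
  by rewrite pidE row_mxKr.
(* mid selects the columns n, ..., n + N - 1, and J projects onto the first
   n + N coordinates. *)
have dT : \det (col_mx Y Ec) = \det (G *m colsub mid AT).
  rewrite mulmx_colsub -middet /Ec last_rowsE -[Y]hsubmxK.
  have -> : col_mx (row_mx (lsubmx Y) (rsubmx Y)) (row_mx 0 1%:M)
     = block_mx (lsubmx Y) (rsubmx Y) 0 1%:M by [].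
  rewrite det_ublock det1 mulr1; congr (\det _).
  by rewrite /Y lsubmx_col_mx pid_l.
have dS : \det (col_mx Y (Ec *m AT)) = \det (G *m (J *m colsub mid AT)).
  pose G2 := rsubmx G.
  have EcAT : Ec *m AT = row_mx a21 (drsubmx AT).
    rewrite /Ec last_rowsE {1}AblockE.
    by rewrite mul_row_block !mul0mx !mul1mx !add0r.
  have GJ : G *m AT = G2 *m (Ec *m AT) + G *m J *m AT.
    rewrite !mulmxA -mulmxDl; congr (_ *m _).
    rewrite /Ec last_rowsE /J -[G]hsubmxK mul_mx_row mul_row_block.
    rewrite !mulmx0 !addr0 !mulmx1 /G2.
    by rewrite add_row_mx add0r addr0.
  pose Y' : 'M[R]_(n + N, n + N + c) := col_mx (pid_mx n) (G *m J *m AT).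
  have -> : col_mx Y (Ec *m AT)
      = block_mx 1%:M (col_mx 0 G2) 0 1%:M *m col_mx Y' (Ec *m AT).
    rewrite mul_block_col !mul1mx mul0mx add0r; congr col_mx.
    rewrite mul_col_mx mul0mx /Y /Y' add_col_mx addr0; congr col_mx.
    by rewrite GJ addrC.
  rewrite det_mulmx det_ublock !det1 !mul1r.
  have GJA0 : rsubmx (G *m J *m AT) = 0.
    rewrite AblockE -[G]hsubmxK /J mul_row_block !mulmx0 !addr0 !mulmx1.
    by rewrite mul_row_block !mulmx0 !mul0mx !addr0 row_mxKr.
  rewrite EcAT -[Y']hsubmxK.
  have -> : rsubmx Y' = 0.
    by rewrite /Y' rsubmx_col_mx GJA0 pid_r col_mx0.
  have -> : col_mx (row_mx (lsubmx Y') 0) (row_mx a21 (drsubmx AT))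
     = block_mx (lsubmx Y') 0 a21 (drsubmx AT) by [].
  rewrite det_lblock.
  have -> : \det (drsubmx AT) = 1.
    rewrite -[drsubmx AT]trmxK det_tr; apply: det_upper_unitriangular => i j ji.
    by rewrite !mxE uA ?leq_add2l // (inj_eq (@rshift_inj _ _)).
  rewrite mulr1 /Y' lsubmx_col_mx pid_l middet mulmxA mulmx_colsub.
  by [].
have JE (f : 'I_N -> 'I_(n + N + c)) :
   \det (rowsub f (J *m colsub mid AT)) = \det (rowsub f (colsub mid AT)) \/
   \det (rowsub f (J *m colsub mid AT)) = 0.
  have Jrow i l : (J *m colsub mid AT) i l =
      if (i < n + N)%N then colsub mid AT i l else 0.
    rewrite !mxE (bigD1 i) //= big1 ?addr0 => [|j ji].
      rewrite !mxE; case: splitP => i' ei; rewrite !mxE; case: splitP => i'' ei'; rewrite !mxE.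
      - by have -> : i' = i'' by [apply: val_inj => /=; lia]; rewrite eqxx mul1r.
      - by have := ltn_ord i'; lia.
      - by have := ltn_ord i''; lia.
      - by rewrite mul0r.
    rewrite !mxE; case: splitP => i' ei; rewrite !mxE; case: splitP => j' ej; rewrite !mxE ?mul0r //.
    case: eqP => [e|_]; last by rewrite mul0r.
    by case/eqP: ji; apply: val_inj; rewrite /= ei ej e.
  have [all_lt|/existsNP[i /negP]] := pselect (forall i, f i < n + N)%N.
    left; congr (\det _); apply/matrixP => i j.
    by rewrite mxE Jrow all_lt !mxE.
  rewrite -leqNgt => le_f; right; rewrite (expand_det_row _ i) big1 // => j _.
  by rewrite mxE Jrow ltnNge le_f mul0r.
have pB (f : 'I_N -> 'I_(n + N + c)) : increasing f -> 0 <= \det (rowsub f (colsub mid AT)).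
  move=> incf; rewrite -[X in \det X](_ : (mxsub mid f A)^T = _).
    by rewrite det_tr pA // => i j /=; rewrite ltn_add2l.
  by apply/matrixP => i j; rewrite !mxE.
have pBJ (f : 'I_N -> 'I_(n + N + c)) : increasing f ->
    0 <= \det (rowsub f (J *m colsub mid AT)).
  by move=> incf; case: (JE f) => ->; rewrite ?pB.
apply/andP; rewrite dS dT; split; first exact: det_mulmx_ge0.
rewrite -(ler_pMn2r (fact_gt0 N)) !cauchy_binet_sym ler_sum // => f _.
by case: (JE f) => ->; rewrite ?mulr0 //; exact: minor_prod_ge0.
Qed.

(** The determinant of a matrix that is square only up to a provable equality
    of its two sizes; it is a junk value for other matrices. *)
Definition rdet m n (A : 'M[R]_(m, n)) : R := \det (conform_mx (0 : 'M[R]_n) A).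

Lemma rdetE n (A : 'M[R]_n) : rdet A = \det A.
Proof. by rewrite /rdet conform_mx_id. Qed.

Lemma last_rows_det n c : \det (col_mx (pid_mx n) (last_rows R c (n + c))) = 1.
Proof.
rewrite pid_mx_rowE last_rowsE.
have -> : col_mx (row_mx 1%:M 0) (row_mx 0 1%:M) = block_mx 1%:M 0 0 1%:M :> 'M[R]_(n + c) by [].
by rewrite det_lblock !det1 mulr1.
Qed.

Lemma last_rows_mul_det n c (A : 'M[R]_(n + c)) : upper_unitriangular A ->
  \det (col_mx (pid_mx n) (last_rows R c (n + c) *m A^T)) = 1.
Proof.
move=> uA; rewrite pid_mx_rowE last_rowsE -[A^T]submxK mul_row_block.
rewrite !mul0mx !mul1mx !add0r.
have -> : col_mx (row_mx 1%:M 0) (row_mx (dlsubmx A^T) (drsubmx A^T))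
   = block_mx 1%:M 0 (dlsubmx A^T) (drsubmx A^T) by [].
rewrite det_lblock det1 mul1r -[drsubmx _]trmxK det_tr.
apply: det_upper_unitriangular => i j ji.
by rewrite !mxE uA ?leq_add2l // (inj_eq (@rshift_inj _ _)).
Qed.

(** Here [T] and [S] are the pieces of dimension [c] of the flags X and A X, [Y]
    is a sum of pieces of later flags and [Z] a piece of the last flag.  Each
    basis occurs once on either side, so both sides scale alike under changes of
    bases, and in the adapted bases the factors with [Z] equal 1. *)
Lemma cross_ratio_le m n N c k (U A : 'M[R]_m) (G : 'M[R]_(N, m))
    (S T : 'M[R]_(c, m)) (Y Z : 'M[R]_(k, m)) :
  (n + N + c)%N = m -> (n + N)%N = k ->
  upper_unitriangular A ->
  (forall (r : nat) (f g : 'I_r -> 'I_m), increasing f -> increasing g ->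
     0 <= \det (mxsub f g A)) ->
  nonneg_minors G ->
  (T == last_rows R c m *m U)%MS ->
  (S == last_rows R c m *m A^T *m U)%MS ->
  (Y == (col_mx (pid_mx n : 'M[R]_(n, m)) (G *m A^T)) *m U)%MS ->
  (Z == (pid_mx k : 'M[R]_(k, m)) *m U)%MS ->
  `|rdet (col_mx Y S)| * `|rdet (col_mx Z T)| <=
  `|rdet (col_mx Y T)| * `|rdet (col_mx Z S)|.
Proof.
move=> em ek; case: m / em U A G S T Y Z => U A G S T; case: k / ek => Y Z.
move=> uA pA pG; have /andP[D0 D1] := det_cross_le uA pA pG.
move=> /eqmxMunitP[hT _ ->] /eqmxMunitP[hS _ ->] /eqmxMunitP[hY _ ->].
move=> /eqmxMunitP[hZ _ ->]; rewrite !rdetE.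
have E (h : 'M[R]_(n + N)) (h' : 'M[R]_c) B B' :
   `|\det (col_mx (h *m (B *m U)) (h' *m (B' *m U)))| =
   `|\det h| * `|\det h'| * `|\det U| * `|\det (col_mx B B')|.
  have -> : col_mx (h *m (B *m U)) (h' *m (B' *m U))
     = block_mx h 0 0 h' *m col_mx B B' *m U.
    by rewrite mul_block_col !mul0mx addr0 add0r mul_col_mx !mulmxA.
  by rewrite !det_mulmx det_lblock !normrM; ring.
rewrite !E last_rows_det last_rows_mul_det // normr1 !mulr1.
rewrite (ger0_norm D0) (ger0_norm (le_trans D0 D1)).
set dS := (X in _ * X * _ <= _); set dT := (X in _ <= _ * X * _).
pose a := `|\det hY| * `|\det hS| * `|\det hZ| * `|\det hT| * `|\det U| ^+ 2.
rewrite [X in X <= _](_ : _ = a * dS); last by rewrite /a; ring.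
rewrite [X in _ <= X](_ : _ = a * dT); last by rewrite /a; ring.
by rewrite ler_wpM2l // !mulr_ge0.
Qed.

End CrossRatio.

(** * Positive tuples of flags in coordinates *)

Import passmx.

Section Coordinates.
Variable R : realType.

(** A matrix represents a subspace as soon as it has the right row vectors. *)
Lemma submx_vecofP (V : vectType R) (e : (\dim {:V}).-tuple V)
   (e_basis : basis_of {:V} e) p (A : 'M[R]_(p, \dim {:V})) (U : {vspace V}) :
  (forall v, (rVof e v <= A)%MS = (v \in U)) ->
  (msof e U :=: A)%MS.
Proof.
move=> AU; apply/eqmxP; apply/andP; split.
  apply/rV_subP => u; rewrite -mem_vecof // -AU.
  by rewrite vecofK.
apply/rV_subP => u; rewrite -mem_vecof // -AU vecofK //.
Qed.

Lemma rVof_msof (V : vectType R) (e : (\dim {:V}).-tuple V)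
   (e_basis : basis_of {:V} e) (U : {vspace V}) v :
  (rVof e v <= msof e U)%MS = (v \in U).
Proof. by rewrite -mem_vecof // rVofK. Qed.

Lemma msof_img (V W : vectType R) (e : (\dim {:V}).-tuple V)
   (f : (\dim {:W}).-tuple W) (e_basis : basis_of {:V} e)
   (f_basis : basis_of {:W} f) (h : 'Hom(V, W)) (U : {vspace V}) :
  (msof f (h @: U) :=: msof e U *m mxof e f h)%MS.
Proof.
apply: submx_vecofP => // w; apply/submxP/memv_imgP => [[u uE]|[v vU ->]].
  exists (vecof e (u *m msof e U)).
    by rewrite mem_vecof // submxMl.
  by rewrite (hom_vecof _ f_basis) -mulmxA -uE rVofK.
have: (rVof e v <= msof e U)%MS by rewrite rVof_msof.
by move=> /submxP[u uE]; exists u; rewrite mulmxA -uE -rVof_app.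
Qed.

Lemma msof_add (V : vectType R) (e : (\dim {:V}).-tuple V)
   (e_basis : basis_of {:V} e) (U W : {vspace V}) :
  (msof e (U + W) :=: msof e U + msof e W)%MS.
Proof.
apply: submx_vecofP => // v; apply/sub_addsmxP/memv_addP.
  move=> [[u w] /= uwE]; exists (vecof e (u *m msof e U)).
    by rewrite mem_vecof // submxMl.
  exists (vecof e (w *m msof e W)).
    by rewrite mem_vecof // submxMl.
  by rewrite -[LHS](rVofK e_basis) uwE linearD.
move=> [u uU [w wW ->]].
have: (rVof e u <= msof e U)%MS by rewrite rVof_msof.
have: (rVof e w <= msof e W)%MS by rewrite rVof_msof.
by move=> /submxP[b bE] /submxP[a aE]; exists (a, b) => /=; rewrite -aE -bE linearD.
Qed.

Lemma mxof_unit (V : vectType R) (e : (\dim {:V}).-tuple V)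
   (e_basis : basis_of {:V} e) (h : 'End(V)) :
  lker h == 0%VS -> mxof e e h \in unitmx.
Proof.
move=> h0; suff /mulmx1_unit[] : mxof e e h *m mxof e e (h^-1)%VF = 1%:M by [].
by rewrite -mxof_comp // lker0_compVf // mxof1 // (basis_free e_basis).
Qed.

Lemma msof_full (V : vectType R) (e : (\dim {:V}).-tuple V)
   (e_basis : basis_of {:V} e) (U : {vspace V}) :
  row_full (msof e U) -> U = fullv.
Proof.
move=> full; apply/vspaceP => v; rewrite memvf -(rVof_msof e_basis).
exact: submx_full.
Qed.

End Coordinates.

(** A minor that vanishes identically on unipotent matrices vanishes on [P] as
    well, so all minors of [P] are nonnegative.  For a shifted interval, the
    identity plus a shifted identity is a witness: its minor is triangular with
    ones on the diagonal. *)
Lemma tp_shift_positive (R : realType) (F : vectType R) (P : 'M[R]_(\dim {:F})) :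
  totally_positive P -> shift_positive P.
Proof.
move=> [uP pP]; split=> [r f g incf incg|N s t hs ht st].
  have [ex|nex] := pselect (exists2 Q : 'M[R]_(\dim {:F}), upper_unipotent Q &
     \det (mxsub f g Q) != 0); first exact/ltW/pP.
  have [->//|P0] := eqVneq (\det (mxsub f g P)) 0.
  by case: nex; exists P.
apply: pP; [exact: increasing_shift_ord | exact: increasing_shift_ord |].
exists (\matrix_(i, j) ((i == j) || (j == i + (t - s) :> nat)%N)%:R).
  move=> i j ji; rewrite mxE; case: eqP => // ij /=.
  case: eqP => // e; case: ij; apply: val_inj => /=; lia.
rewrite [X in X != 0](_ : _ = 1) ?oner_eq0 //.
rewrite det_trig.
  rewrite big1 // => i _; rewrite !mxE /= (_ : (_ == _ :> nat) = true) ?orbT //.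
  by apply/eqP; lia.
apply/is_trig_mxP => i j ij; rewrite !mxE.
have -> : (shift_ord hs i == shift_ord ht j) = false.
  by apply/eqP => /(congr1 val) /=; lia.
by rewrite (_ : (_ == _ :> nat) = false) //; apply/eqP => /=; lia.
Qed.

Section PositiveTuples.
Variables (R : realType) (F : vectType R).
Local Notation m := (\dim {:F}).
Local Notation e := (vbasis {:F}).
Let e_basis : basis_of {:F} e := vbasisP fullv.

Lemma msof_span (X : seq F) p (A : 'M[R]_(p, m)) :
  (forall v, v \in X -> (rVof e v <= A)%MS) ->
  (forall i, exists2 v, v \in X & row i A = rVof e v) ->
  (msof e <<X>>%VS :=: A)%MS.
Proof.
move=> XA AX; apply/eqmxP/andP; split.
  rewrite -(genmxE A) msof_sub //; apply/span_subvP => v vX.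
  by rewrite -rVof_sub // genmxE XA.
apply/row_subP => i; have [v vX ->] := AX i.
by rewrite rVof_msof // memv_span.
Qed.

Lemma msof_flag_X j : (j <= m)%N -> (msof e (flag_X F j) :=: last_rows R j m)%MS.
Proof.
move=> jm; have row_last (a : 'I_j) (lt_m : (m - j + a < m)%N) :
    row a (last_rows R j m) = rVof e e`_(m - j + a).
  rewrite (rVofE e_basis (Ordinal lt_m)); apply/rowP => b; rewrite !mxE eqxx /=.
  by rewrite -val_eqE.
apply: msof_span => [v /(nthP 0)[b]|a].
  rewrite size_drop size_tuple nth_drop => b_lt <-.
  have bj : (b < j)%N by lia.
  rewrite -(row_last (Ordinal bj)) ?row_sub //=; lia.
have lt_m : (m - j + a < m)%N by have := ltn_ord a; lia.
exists e`_(m - j + a); last exact: row_last.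
rewrite -nth_drop mem_nth // size_drop size_tuple.
by have := ltn_ord a; lia.
Qed.

Lemma msof_flag_Z j : (j <= m)%N -> (msof e (flag_Z F j) :=: (pid_mx j : 'M[R]_(j, m)))%MS.
Proof.
move=> jm; have row_first (a : 'I_j) (lt_m : (a < m)%N) :
    row a (pid_mx j : 'M[R]_(j, m)) = rVof e e`_a.
  rewrite (rVofE e_basis (Ordinal lt_m)); apply/rowP => b; rewrite !mxE eqxx /=.
  by rewrite -val_eqE /= ltn_ord andbT eq_sym.
apply: msof_span => [v /(nthP 0)[b]|a].
  rewrite size_take size_tuple; case: ifP => [_|/negP/negP le_m] b_lt.
    rewrite nth_take // => <-.
    by rewrite -(row_first (Ordinal b_lt)) ?row_sub //=; lia.
  have bj : (b < j)%N by lia.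
  rewrite nth_take // => <-.
  by rewrite -(row_first (Ordinal bj)) ?row_sub //=; lia.
have lt_m : (a < m)%N by have := ltn_ord a; lia.
exists e`_a; last exact: row_first.
rewrite -(nth_take _ (ltn_ord a)) mem_nth // size_take size_tuple.
by have := ltn_ord a; case: ifP; lia.
Qed.

Lemma msof_mx_endo (P : 'M[R]_m) (V : {vspace F}) :
  (msof e (mx_endo P @: V) :=: msof e V *m P^T)%MS.
Proof. by have := msof_img e_basis e_basis (mx_endo P) V; rewrite hommxK. Qed.

Fixpoint nested_flags (ns : seq nat) (P : nat -> 'M[R]_m) : {vspace F} :=
  if ns is n :: ns' then
    (flag_X F n + mx_endo (P 0%N) @: nested_flags ns' (P \o succn))%VS
  else 0%VS.

Lemma msof_nested_flags ns P : (sumn ns <= m)%N ->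
  (msof e (nested_flags ns P) :=: nested_span ns P)%MS.
Proof.
elim: ns P => [|n ns IHns] P /= le_m.
  by apply/eqmxP; rewrite msof0 ?submx_refl.
apply: eqmx_trans (msof_add e_basis _ _) _; apply: adds_eqmx.
  by apply: msof_flag_X; lia.
by apply: eqmx_trans (msof_mx_endo _ _) _; apply: eqmxMr; apply: IHns; lia.
Qed.

Lemma mx_endoM (P Q : 'M[R]_m) : mx_endo (P *m Q) = (mx_endo P \o mx_endo Q)%VF.
Proof. by rewrite /mx_endo trmx_mul (hommx_mul e_basis e_basis e_basis). Qed.

Lemma mx_endo1 : mx_endo (1%:M : 'M[R]_m) = \1%VF.
Proof. by rewrite /mx_endo trmx1 hommx1. Qed.

(** Distributing the matrices over the nested sum recovers the products occurring
    in the definition of a positive tuple. *)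
Lemma nested_flags_sum ns P :
  nested_flags ns P =
  (\sum_(i < size ns)
     mx_endo (\big[mulmx/1%:M]_(0 <= l < i) P l) @: flag_X F (nth 0%N ns i))%VS.
Proof.
elim: ns P => [|n ns IHns] P /=; first by rewrite big_ord0.
rewrite big_ord_recl big_geq // mx_endo1 lim1g; congr (_ + _)%VS.
rewrite IHns limg_sum; apply: eq_bigr => i _ /=.
rewrite -limg_comp -mx_endoM /bump /= add1n.
by rewrite big_nat_recl.
Qed.


Lemma sumn_mkseq (f : nat -> nat) N : sumn (mkseq f N) = (\sum_(i < N) f i)%N.
Proof. by rewrite sumnE /mkseq big_map -{1}[N]subn0 -/(index_iota 0 N) big_mkord. Qed.

Lemma flag_X0 : flag_X F 0 = 0%VS.
Proof. by rewrite /flag_X subn0 drop_oversize ?size_tuple // span_nil. Qed.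

Lemma flag_Z0 : flag_Z F 0 = 0%VS.
Proof. by rewrite /flag_Z take0 span_nil. Qed.

(** The normal form of a positive tuple, extended to the trivial pieces of
    dimension 0. *)
Lemma positive_tuple_normal N (x : 'I_N.+1 -> nat -> {vspace F}) :
  positive_tuple x -> (forall i, x i 0%N = 0%VS) ->
  exists (T : 'End(F)) (P : nat -> 'M[R]_m),
    [/\ lker T == 0%VS, forall l, (l < N.+1 - 2)%N -> totally_positive (P l) &
      forall i j, (j < m)%N -> (T @: x i j)%VS =
        if i == ord_max then flag_Z F j
        else (mx_endo (\big[mulmx/1%:M]_(0 <= l < i) P l) @: flag_X F j)%VS].
Proof.
move=> [_ [g [P [posP gx]]]] x0; exists (PGL_lift g), P; split => //.
  exact: (valP (generic_quotient.repr g)).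
move=> i [|j] jm; last by rewrite -[LHS]/(PGL_act _ _) gx.
by rewrite x0 limg0 flag_X0 flag_Z0 limg0 if_same.
Qed.

(** The tuple is a nested span followed by the flag Z, which supplies the first
    basis vectors. *)
Lemma positive_tuple_span N (x : 'I_N.+1 -> nat -> {vspace F}) (n : 'I_N.+1 -> nat) :
  positive_tuple x -> (forall i, x i 0%N = 0%VS) -> (forall i, (n i < m)%N) ->
  (\sum_i n i)%N = m -> (\sum_i x i (n i))%VS = fullv.
Proof.
move=> posx x0 nm sum_n; have [T [P [T0 posP Tx]]] := positive_tuple_normal posx x0.
suff full : (T @: (\sum_i x i (n i)))%VS = fullv.
  have cap0 V : (V :&: lker T = 0)%VS by rewrite (eqP T0) capv0.
  by apply/eqP; rewrite eqEdim subvf -(limg_dim_eq (cap0 (\sum_i x i (n i))%VS)) full /=.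
pose ns := mkseq (fun j => n (inord j)) N.
have TE : (T @: (\sum_i x i (n i)) = nested_flags ns P + flag_Z F (n ord_max))%VS.
  rewrite limg_sum big_ord_recr /= Tx // eqxx; congr (_ + _)%VS.
  rewrite nested_flags_sum size_mkseq; apply: eq_bigr => i _.
  rewrite Tx // ifN; last by rewrite -val_eqE /= ltn_eqF.
  rewrite nth_mkseq //; congr (_ @: flag_X F (n _))%VS.
  by apply: val_inj; rewrite /= inordK // ltnW // ltnS.
have sum_ns : (sumn ns + n ord_max)%N = m.
  rewrite -sum_n big_ord_recr /=; congr (_ + _)%N.
  rewrite sumn_mkseq.
  by apply: eq_bigr => i _; congr n; apply: val_inj; rewrite /= inordK // ltnW // ltnS.
apply: (msof_full e_basis); rewrite TE /row_full (msof_add e_basis).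
have eZ := msof_flag_Z (ltnW (nm ord_max)).
have eX := @msof_nested_flags ns P ltac:(lia).
rewrite (adds_eqmx eX eZ); apply: nested_span_full => // l.
by rewrite size_mkseq => lN; apply: tp_shift_positive; apply: posP; lia.
Qed.

(** The first two flags are X and P_0 X.  All the later ones but the last are
    P_0 times a nested span, in which the flag X itself gets multiplicity 0; the
    last one is Z. *)
Lemma positive_tuple_cross r (x : 'I_r.+3 -> nat -> {vspace F})
    (n : 'I_r.+1 -> nat) c k (S T : 'M[R]_(c, m)) (Y Z : 'M[R]_(k, m)) :
  positive_tuple x -> (forall i, x i 0%N = 0%VS) ->
  (0 < c)%N -> (c + k)%N = m -> (0 < k)%N -> (\sum_j n j)%N = k ->
  (T :=: msof e (x ord0 c))%MS -> (S :=: msof e (x (lift ord0 ord0) c))%MS ->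
  (Y :=: msof e (\sum_j x (lift ord0 (lift ord0 j)) (n j))%VS)%MS ->
  (Z :=: msof e (x ord_max k))%MS ->
  `|rdet (col_mx Y S)| * `|rdet (col_mx Z T)| <=
  `|rdet (col_mx Y T)| * `|rdet (col_mx Z S)|.
Proof.
move=> posx x0 c0 ck k0 sum_n eT eS eY eZ.
have [h [P [h0 posP hx]]] := positive_tuple_normal posx x0.
have nk j : (n j <= k)%N by rewrite -sum_n (bigD1 j) //= leq_addr.
have km : (k < m)%N by lia.
have nm j : (n j < m)%N by exact: leq_ltn_trans km.
pose h1 := mxof e e h; have h1u : h1 \in unitmx by exact: mxof_unit.
have back p (B : 'M[R]_(p, m)) (V : {vspace F}) q (C : 'M[R]_(q, m)) :
    (B :=: msof e V)%MS -> (msof e (h @: V)%VS :=: C)%MS -> (B :=: C *m invmx h1)%MS.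
  move=> eB eC; apply: eqmx_trans eB _.
  apply: eqmx_trans (eqmxMr _ (eqmx_trans (eqmx_sym (msof_img e_basis e_basis h V)) eC)).
  by rewrite mulmxK //; exact: eqmx_refl.
have uniA : upper_unitriangular (P 0%N).
  by have [] := posP 0%N ltac:(lia).
have [posA _] := tp_shift_positive (posP 0%N ltac:(lia)).
pose ns := mkseq (fun j => n (inord j)) r.
have sum_ns : (sumn ns + n ord_max)%N = k.
  rewrite -sum_n big_ord_recr /=; congr (_ + _)%N.
  rewrite sumn_mkseq.
  by apply: eq_bigr => i _; congr n; apply: val_inj; rewrite /= inordK // ltnW // ltnS.
have [||N [G [_ [eN eG posG _]]]] := @nested_span_basis R m (0%N :: ns) (P \o succn).
- by rewrite /=; lia.
- move=> l; rewrite /= size_mkseq => lr; apply: tp_shift_positive.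
  by apply: posP; lia.
apply: (@cross_ratio_le R m (n ord_max) N c k (invmx h1) (P 0%N) G) => //.
- by rewrite eN /=; lia.
- by rewrite eN /=; lia.
- apply/eqmxP; apply: back eT _; rewrite hx ?big_geq ?mx_endo1 ?lim1g //=; last lia.
  by apply: msof_flag_X; lia.
- apply/eqmxP; apply: back eS _; rewrite hx //=; last lia.
  rewrite (_ : bump 0 0 = 1%N) // big_nat_recl // big_geq // mulmx1; apply: eqmx_trans (msof_mx_endo _ _) _.
  by apply: eqmxMr; apply: msof_flag_X; lia.
- apply/eqmxP; apply: back eY _.
  have -> : (h @: (\sum_j x (lift ord0 (lift ord0 j)) (n j)) =
      flag_Z F (n ord_max) + mx_endo (P 0%N) @: nested_flags (0%N :: ns) (P \o succn))%VS.
    rewrite limg_sum big_ord_recr /= addvC hx // ifT; last first.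
      by rewrite -val_eqE /= /bump /= !add1n.
    congr (_ + _)%VS; rewrite flag_X0 add0v nested_flags_sum -limg_comp.
    rewrite limg_sum size_mkseq; apply: eq_bigr => j _.
    rewrite hx // ifN; last first.
      by rewrite -val_eqE /= /bump /= !add1n !eqSS ltn_eqF.
    rewrite -limg_comp -!mx_endoM /= /bump /= !add1n !big_nat_recl // -?mulmxA.
    rewrite nth_mkseq //; congr (_ @: flag_X F (n _))%VS.
    by apply: val_inj; rewrite /= inordK // ltnW // ltnS.
  apply: eqmx_trans (msof_add e_basis _ _) _; apply: eqmx_trans _ (addsmxE _ _).
  apply: adds_eqmx; first by apply: msof_flag_Z; exact: ltnW.
  apply: eqmx_trans (msof_mx_endo _ _) _; apply: eqmxMr.
  apply: eqmx_trans _ (eqmx_sym eG); apply: msof_nested_flags.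
  by rewrite /=; lia.
- apply/eqmxP; apply: back eZ _; rewrite hx // eqxx.
  by apply: msof_flag_Z; exact: ltnW.
Qed.

End PositiveTuples.

(** * Topology of Grassmannians *)

Section MatrixLimits.
Variable R : realType.

Lemma cvg_mxP T (F : set_system T) {FF : Filter F} m n (f : T -> 'M[R]_(m, n))
  (A : 'M[R]_(m, n)) :
  (forall i j, f t i j @[t --> F] --> A i j) -> f t @[t --> F] --> A.
Proof.
move=> fA B [P PA sPB].
suff : \forall t \near F, forall i j, P i j (f t i j).
  by apply: filterS => t Pt; exact: sPB.
apply: filter_forall => i; apply: filter_forall => j.
exact: (fA i j _ (PA i j)).
Qed.

Lemma cvg_det T (F : set_system T) {FF : Filter F} n (f : T -> 'M[R]_n)
  (A : 'M[R]_n) :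
  (forall i j, f t i j @[t --> F] --> A i j) ->
  \det (f t) @[t --> F] --> \det A.
Proof.
move=> fA; apply: cvg_big; first exact: add_continuous.
move=> s _; apply: cvgM; first exact: cvg_cst.
apply: cvg_big; first exact: mul_continuous.
by move=> i _; exact: fA.
Qed.

(** If the sizes do not match, [rdet] is constant. *)
Lemma cvg_rdet_col p a n (Y : 'M[R]_(p, n)) (N0 : 'M[R]_(a, n)) :
  (rdet (col_mx Y N) : R) @[N --> N0] --> (rdet (col_mx Y N0) : R).
Proof.
have [e|ne] := eqVneq (p + a)%N n; last first.
  have E (N : 'M[R]_(a, n)) : rdet (col_mx Y N) = \det (0 : 'M[R]_n).
    by congr (\det _); apply: nonconform_mx; rewrite ne.
  by rewrite (funext E) E; apply: (@cvg_cst R _ _ (nbhs N0)); exact: nbhs_filter.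
case: n / e Y N0 => Y N0; under eq_cvg do rewrite rdetE; rewrite rdetE.
apply: (@cvg_det _ _ (nbhs_filter N0)) => i j; rewrite mxE.
under eq_cvg do rewrite mxE.
case: splitP => l _; last exact: coord_continuous.
by apply: (@cvg_cst R _ _ (nbhs N0)); exact: nbhs_filter.
Qed.

Lemma rdet_col_mulr p a n (Y : 'M[R]_(p, n)) (N : 'M[R]_(a, n)) (h : 'M[R]_a) :
  (p + a)%N = n -> rdet (col_mx Y (h *m N)) = \det h * rdet (col_mx Y N).
Proof.
move=> e; case: n / e Y N => Y N; rewrite !rdetE.
have -> : col_mx Y (h *m N) = block_mx 1%:M 0 0 h *m col_mx Y N.
  by rewrite mul_block_col !mul0mx mul1mx addr0 add0r.
by rewrite det_mulmx det_lblock det1 mul1r.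
Qed.

Lemma near_rdet_lt a b n (A B : 'M[R]_(b, n)) (u v : R) (M : 'M[R]_(a, n)) :
  u * `|rdet (col_mx A M)| < v * `|rdet (col_mx B M)| ->
  \forall N \near M, u * `|rdet (col_mx A N)| < v * `|rdet (col_mx B N)|.
Proof.
rewrite -subr_gt0 => lt_M.
have cvg1 w (A' : 'M[R]_(b, n)) :
    w * `|rdet (col_mx A' N)| @[N --> M] --> w * `|rdet (col_mx A' M)|.
  apply: (@cvgM _ _ _ (nbhs_filter M)); first exact: (@cvg_cst R _ _ _ (nbhs_filter M)).
  exact: (@cvg_norm _ _ _ _ (nbhs_filter M) _ _ (@cvg_rdet_col b a n A' M)).
have cvg2 := @cvgB _ _ _ _ (nbhs_filter M) _ _ _ _ (cvg1 v B) (cvg1 u A).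
have ev : \forall N \near M,
    0 < v * `|rdet (col_mx B N)| - u * `|rdet (col_mx A N)| := cvgr_gt _ cvg2 _ lt_M.
by near=> N; rewrite -subr_gt0; near: N; exact: ev.
Unshelve. all: by end_near. Qed.

Lemma rdet_lt_mul a b n (A B : 'M[R]_(b, n)) (u v : R) (M : 'M[R]_(a, n)) (h : 'M[R]_a) :
  (b + a)%N = n -> h \in unitmx ->
  u * `|rdet (col_mx A M)| < v * `|rdet (col_mx B M)| ->
  u * `|rdet (col_mx A (h *m M))| < v * `|rdet (col_mx B (h *m M))|.
Proof.
move=> ba hu; rewrite !rdet_col_mulr // !normrM !(mulrCA _ `|\det h|) ltr_pM2l //.
by rewrite normr_gt0 -unitfE -unitmxE.
Qed.

End MatrixLimits.

Section RowSpans.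
Variables (R : realType) (E : vectType R).
Local Notation d := (\dim {:E}).
Local Notation e := (vbasis {:E}).
Let e_basis : basis_of {:E} e := vbasisP fullv.

Lemma msof_row_span k (M : 'M[R]_(k, d)) : (msof e (row_span M) :=: M)%MS.
Proof.
apply: msof_span => [v /fintype.imageP[i _ ->]|i]; first by rewrite vecofK ?row_sub.
by exists (vecof e (row i M)); rewrite ?fintype.image_f // vecofK.
Qed.

Lemma msof_inj (U V : {vspace E}) : (msof e U :=: msof e V)%MS -> U = V.
Proof.
move=> UV; apply: subv_anti; rewrite -!(sub_msof e_basis).
by rewrite !UV submx_refl.
Qed.

Lemma row_span_eqmx k l (M : 'M[R]_(k, d)) (N : 'M[R]_(l, d)) :
  (row_span M = row_span N) <-> (M :=: N)%MS.
Proof.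
split=> [MN|MN].
  apply: eqmx_trans (eqmx_sym (msof_row_span M)) _; rewrite MN.
  exact: msof_row_span.
apply: msof_inj; apply: eqmx_trans (msof_row_span M) _.
exact: eqmx_trans MN (eqmx_sym (msof_row_span N)).
Qed.

Lemma row_span_surj k (V : {vspace E}) : \dim V = k ->
  exists2 M : 'M[R]_(k, d), row_free M & row_span M = V.
Proof.
move=> <-; exists (\matrix_(i < \dim V) rVof e (vbasis V)`_i).
  apply: inj_row_free => u uM0; apply/rowP => i; rewrite mxE.
  have /freeP fr := basis_free (vbasisP V); apply: (fr (fun i => u 0 i)).
  apply: (can_inj (rVofK e_basis)); rewrite linear0 -uM0 mulmx_sum_row linear_sum.
  by apply: eq_bigr => j _; rewrite rowK linearZ.
apply: msof_inj; apply: eqmx_trans (msof_row_span _) _; apply: eqmx_sym.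
have -> : msof e V = msof e <<vbasis V>>%VS by rewrite (span_basis (vbasisP V)).
apply: msof_span => [v vV|i].
  have iV : (index v (vbasis V) < \dim V)%N by rewrite -[X in (_ < X)%N](size_tuple (vbasis V)) index_mem.
  rewrite -(nth_index 0 vV) -(rowK (fun i : 'I_(\dim V) => rVof e (vbasis V)`_i) (Ordinal iV)).
  exact: row_sub.
by exists (vbasis V)`_i; rewrite ?rowK // mem_nth // size_tuple.
Qed.

Lemma dim_row_span k (M : 'M[R]_(k, d)) : row_free M -> \dim (row_span M) = k.
Proof.
move=> fM; have [N fN NM] := row_span_surj (erefl (\dim (row_span M))).
move: fN fM => /eqP fN /eqP fM; rewrite -[RHS]fM -[LHS]fN.
by apply: eqmx_rank; apply/eqmxP/row_span_eqmx.
Qed.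

Lemma row_span_full k (M : 'M[R]_(k, d)) : row_full M <-> row_span M = fullv.
Proof.
split=> [full|MV].
  by apply: (msof_full e_basis); rewrite /row_full msof_row_span.
rewrite -sub1mx; apply/rV_subP => u _; rewrite -(msof_row_span M) MV.
by rewrite -(mem_vecof e_basis) memvf.
Qed.

Lemma row_span_col k l (M : 'M[R]_(k, d)) (N : 'M[R]_(l, d)) :
  row_span (col_mx M N) = (row_span M + row_span N)%VS.
Proof.
apply: msof_inj; apply: eqmx_trans (msof_row_span _) _; apply: eqmx_sym.
apply: eqmx_trans (msof_add e_basis _ _) _; apply: eqmx_trans _ (addsmxE _ _).
by apply: adds_eqmx; exact: msof_row_span.
Qed.

Lemma rdet_neq0 k (M : 'M[R]_(k, d)) : k = d ->
  (rdet M != 0) <-> row_span M = fullv.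
Proof.
move=> kd; apply: iff_trans _ (row_span_full M).
by case: _ / kd (M) => N; rewrite rdetE row_full_unit unitmxE unitfE.
Qed.

Lemma rdet_col_neq0 k l (M : 'M[R]_(k, d)) (N : 'M[R]_(l, d)) : (k + l)%N = d ->
  (rdet (col_mx M N) != 0) <-> (row_span M + row_span N)%VS = fullv.
Proof. by move=> kl; rewrite -row_span_col; exact: rdet_neq0. Qed.

Lemma img_row_span k (M : 'M[R]_(k, d)) (h : 'End(E)) :
  (h @: row_span M)%VS = row_span (M *m mxof e e h).
Proof.
apply: msof_inj; apply: eqmx_trans (msof_img e_basis e_basis _ _) _.
apply: eqmx_trans (eqmxMr _ (msof_row_span M)) _; apply: eqmx_sym.
exact: msof_row_span.
Qed.

(** The topology is tested on bases, and two bases of the same subspace differ by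
    an invertible matrix; this is how open conditions on determinants become
    open sets of subspaces. *)
Lemma Grass_open_bases a (C : set 'M[R]_(a, d)) :
  (forall M, C M -> \forall N \near M, C N) ->
  (forall (h : 'M[R]_a) M, h \in unitmx -> C M -> C (h *m M)) ->
  open ([set V | exists2 M, row_free M /\ C M & row_span M = V] : set (Grass E)).
Proof.
move=> oC hC; change (Grass_open [set V : Grass E | exists2 M, row_free M /\ C M & row_span M = V]).
move=> k M fM [M' [fM' CM'] eM'].
have ka : k = a by rewrite -(dim_row_span fM) -(dim_row_span fM') eM'.
case: a / ka C oC hC M' fM' CM' eM' => C oC hC M' _ CM' eM'.
have /eqmxP/eqmxMunitP[h h_unit Mh] : (M :=: M')%MS by apply/row_span_eqmx.
have : C M by rewrite Mh; exact: hC.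
by move=> /oC; apply: filterS => N CN fN; exists N.
Qed.

Lemma Grass_img_continuous (h : 'End(E)) : lker h == 0%VS ->
  continuous (fun V : Grass E => (h @: V)%VS : Grass E).
Proof.
move=> h0; apply/continuousP => O oO; change (Grass_open [set V : Grass E | O (h @: V)%VS]).
move=> k M fM /=; rewrite img_row_span => OM.
have hu : mxof e e h \in unitmx by exact: mxof_unit.
have freeM (N : 'M[R]_(k, d)) : row_free N -> row_free (N *m mxof e e h).
  by rewrite /row_free mxrankMfree // row_free_unit.
have cvg_mul : (N *m mxof e e h) @[N --> M] --> (M *m mxof e e h).
  apply: (@cvg_mxP _ _ _ (nbhs_filter M)) => i j; rewrite mxE.
  under eq_cvg do rewrite mxE.
  apply: (@cvg_big _ _ _ _ _ add_continuous _ _ _ _ _ (nbhs_filter M)) => l _.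
  apply: (@cvgM _ _ _ (nbhs_filter M)); first exact: coord_continuous.
  exact: (@cvg_cst R _ _ _ (nbhs_filter M)).
have ev : \forall N \near M, row_free (N *m mxof e e h) ->
    O (row_span (N *m mxof e e h)) := cvg_mul _ (oO _ _ (freeM _ fM) OM).
near=> N => fN; rewrite img_row_span.
by apply: (near ev N) => //; exact: freeM.
Unshelve. all: by end_near. Qed.

End RowSpans.

(** * Determinants modulo a subspace *)

Section QuotientDeterminant.
Variable R : realType.

(** The columns of [Q] identify the quotient by the row space of [P] with
    coordinate vectors.  Modulo [P], the rows of [M] are determined by M Q; the
    constant is the determinant of a section of [Q] completed by [P]. *)
Lemma rdet_mod_kernel d k l (Q : 'M[R]_(d, k)) (P : 'M[R]_(l, d)) :
  (k + l)%N = d -> row_full Q -> row_free P -> P *m Q = 0 ->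
  (forall w : 'rV_d, w *m Q = 0 -> (w <= P)%MS) ->
  exists2 c : R, c != 0 & forall M : 'M[R]_(k, d),
    rdet (col_mx M P) = c * rdet (M *m Q).
Proof.
move=> kl; case: d / kl Q P => Q P /row_fullP[B BQ] fP PQ0 kerQ.
have unitBP : row_free (col_mx B P).
  apply: inj_row_free => v; rewrite -[v]hsubmxK mul_row_col => v0.
  have vl0 : lsubmx v = 0.
    have := congr1 (mulmx^~ Q) v0.
    by rewrite /= mulmxDl mul0mx -!mulmxA BQ PQ0 mulmx0 addr0 mulmx1.
  move: v0; rewrite vl0 mul0mx add0r => /eqP; rewrite mulmx_free_eq0 // => /eqP ->.
  by rewrite row_mx0.
exists (\det (col_mx B P)); first by rewrite -unitfE -unitmxE -row_free_unit.
move=> M; rewrite !rdetE.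
have /submxP[C CE] : (M - M *m Q *m B <= P)%MS.
  apply/row_subP => i; apply: kerQ.
  by rewrite -row_mul mulmxBl -!mulmxA BQ mulmx1 subrr row0.
have -> : col_mx M P = block_mx (M *m Q) C 0 1%:M *m col_mx B P.
  by rewrite mul_block_col mul0mx mul1mx add0r -CE addrC subrK.
by rewrite det_mulmx det_ublock det1 mulr1 mulrC.
Qed.

Variable E : vectType R.
Local Notation d := (\dim {:E}).
Local Notation e := (vbasis {:E}).
Let e_basis : basis_of {:E} e := vbasisP fullv.

Lemma dim_quot_space (U : {vspace E}) : \dim {:quot_space U} = (d - \dim U)%N.
Proof.
have := limg_ker_dim (quot_proj U) fullv.
by rewrite quot_proj_img quot_proj_ker capfv => <-; rewrite addKn.
Qed.

Lemma rdet_quot (U : {vspace E}) k l (P : 'M[R]_(l, d)) :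
  row_free P -> row_span P = U -> (k + l)%N = d ->
  exists2 c : R, c != 0 & forall M : 'M[R]_(k, d),
    rdet (col_mx M P) =
    c * rdet (M *m mxof e (vbasis {:quot_space U}) (quot_proj U)).
Proof.
move=> fP PU kl; have f_basis : basis_of {:quot_space U} (vbasis {:quot_space U}).
  exact: vbasisP.
have dimU : \dim U = l by rewrite -PU dim_row_span.
have kE : k = \dim {:quot_space U} by rewrite dim_quot_space dimU -kl addnK.
rewrite kE in kl *; apply: rdet_mod_kernel => //.
- rewrite -sub1mx; apply/rV_subP => u _.
  have : vecof (vbasis {:quot_space U}) u \in limg (quot_proj U).
    by rewrite quot_proj_img memvf.
  move=> /memv_imgP[v _ uv]; rewrite -[u](vecofK f_basis) uv.
  by rewrite (rVof_app _ e_basis) submxMl.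
- apply/row_matrixP => i; rewrite row_mul row0 mul_mxof.
  have : vecof e (row i P) \in lker (quot_proj U).
    by rewrite quot_proj_ker -PU (mem_vecof e_basis) msof_row_span row_sub.
  by rewrite memv_ker => /eqP ->; rewrite linear0.
- move=> w; rewrite mul_mxof => /eqP; rewrite (rVof_eq0 f_basis) => w0.
  have : vecof e w \in lker (quot_proj U) by rewrite memv_ker.
  by rewrite quot_proj_ker (mem_vecof e_basis) -PU msof_row_span.
Qed.

End QuotientDeterminant.

(** * Attracting subspaces *)

Section Attractor.
Variables (R : realType) (E : vectType R).
Local Notation d := (\dim {:E}).
Local Notation e := (vbasis {:E}).
Let e_basis : basis_of {:E} e := vbasisP fullv.
Variables (A B : {vspace E}).
Hypotheses (AB0 : (A :&: B = 0)%VS) (ABE : (A + B = fullv)%VS).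

(** A homothety of [B] extended by the identity of [A]. *)
Definition homothety (c : R) : 'End(E) := daddv_pi A B + c *: daddv_pi B A.

Lemma homothetyE c a b : a \in A -> b \in B -> homothety c (a + b) = a + c *: b.
Proof.
move=> aA bB; have BA0 : (B :&: A = 0)%VS by rewrite capvC.
have piA0 : daddv_pi A B b = 0.
  have := daddv_pi_add BA0 (w := b); rewrite daddv_pi_id // => h.
  have bAB : b \in (B + A)%VS by rewrite addvC ABE memvf.
  by apply: (addrI b); rewrite addr0; exact: h.
have piB0 : daddv_pi B A a = 0.
  have := daddv_pi_add AB0 (w := a); rewrite daddv_pi_id // => h.
  have aAB : a \in (A + B)%VS by rewrite ABE memvf.
  by apply: (addrI a); rewrite addr0; exact: h.
by rewrite add_lfunE scale_lfunE !linearD /= piA0 piB0 !daddv_pi_id // addr0 ?scaler0 add0r.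
Qed.

Lemma split_fullv v : exists a b, [/\ a \in A, b \in B & v = a + b].
Proof.
have : v \in (A + B)%VS by rewrite ABE memvf.
by move=> /memv_addP[a aA [b bB ->]]; exists a, b.
Qed.

Lemma homothetyM c c' v : homothety c (homothety c' v) = homothety (c * c') v.
Proof.
have [a [b [aA bB ->]]] := split_fullv v.
by rewrite !homothetyE ?memvZ // scalerA.
Qed.

Lemma homothety1 v : homothety 1 v = v.
Proof.
have [a [b [aA bB ->]]] := split_fullv v.
by rewrite homothetyE // scale1r.
Qed.

Lemma homothetyK c : c != 0 -> cancel (homothety c) (homothety c^-1).
Proof. by move=> c0 v; rewrite homothetyM mulVf // homothety1. Qed.

Lemma lker_homothety c : c != 0 -> lker (homothety c) == 0%VS.
Proof. by move=> c0; apply/lker0P; exact: can_inj (homothetyK c0). Qed.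

Lemma homothety_img c : (homothety c @: A = A)%VS.
Proof.
apply/vspaceP => v; apply/memv_imgP/idP => [[a aA ->]|vA].
  by rewrite -[a]addr0 homothetyE ?mem0v // scaler0 addr0.
by exists v => //; rewrite -[v in RHS]addr0 homothetyE ?mem0v // scaler0 addr0.
Qed.

Lemma homothety_comm (h : 'End(E)) c :
  (h @: A <= A)%VS -> (h @: B <= B)%VS ->
  (homothety c \o h = h \o homothety c)%VF.
Proof.
move=> hA hB; apply/lfunP => v; rewrite !comp_lfunE.
have [a [b [aA bB ->]]] := split_fullv v.
rewrite homothetyE // [h (a + b)]linearD [h (a + c *: b)]linearD /=.
rewrite homothetyE ?linearZ //.
  by apply: subvP hA _ _; exact: memv_img.
by apply: subvP hB _ _; exact: memv_img.
Qed.

(** A complement [W] of [B] is a graph over [A], which the homotheties flatten to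
    [A] itself as [c] tends to 0. *)
Lemma homothety_cvg (W : {vspace E}) (U : set (Grass E)) :
  \dim W = \dim A -> (W :&: B = 0)%VS -> nbhs (A : Grass E) U ->
  exists2 c : R, c != 0 & U (homothety c @: W)%VS.
Proof.
move=> dimW WB0; rewrite nbhsE => -[OO [oO OA] OU].
have [M fM MW] := row_span_surj dimW.
pose MA := M *m mxof e e (daddv_pi A B); pose MB := M *m mxof e e (daddv_pi B A).
have imgM c : (homothety c @: W)%VS = row_span (MA + c *: MB).
  by rewrite -MW img_row_span /homothety linearD linearZ /= mulmxDr -scalemxAr.
have spanMA : row_span MA = A.
  rewrite -img_row_span MW; apply/eqP; rewrite eqEdim.
  apply/andP; split.
    by apply/subvP => _ /memv_imgP[w _ ->]; exact: memv_pi.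
  rewrite -dimW limg_dim_eq //; apply/eqP; rewrite -subv0; apply/subvP => w.
  rewrite memv_cap memv_ker => /andP[wW /eqP w0].
  have [a [b [aA bB wE]]] := split_fullv w.
  have := daddv_pi_add AB0 (w := w); rewrite ABE memvf w0 add0r => /(_ isT) wB.
  rewrite -WB0 memv_cap wW -wB; exact: memv_pi.
have fMA : row_free MA.
  have [N fN NA] := row_span_surj (erefl (\dim A)).
  have /row_span_eqmx eN : row_span MA = row_span N by rewrite spanMA NA.
  by rewrite /row_free eN.
have /(_ _ MA fMA) ev : Grass_open OO by exact: oO.
have {}ev := ev ltac:(by rewrite spanMA).
have cvgM : (MA + c *: MB) @[c --> (0 : R)^'] --> MA.
  apply: cvg_mxP => i j; rewrite -[MA i j]addr0 -[X in _ + X](mul0r (MB i j)).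
  under eq_cvg do rewrite mxE [X in _ + X]mxE.
  apply: cvgD; first exact: cvg_cst.
  apply: cvgM; last exact: cvg_cst.
  by apply: cvg_within_filter; exact: cvg_id.
have {}ev : \forall c \near (0 : R)^', row_free (MA + c *: MB) ->
  OO (row_span (MA + c *: MB)) := cvgM _ ev.
have : \forall c \near (0 : R)^', c != 0 /\ OO (homothety c @: W)%VS.
  near=> c; have c0 : c != 0 by near: c; exact: nbhs_dnbhs_neq.
  split => //; rewrite imgM; apply: (near ev c) => //.
  have [N fN NE] := row_span_surj (k := \dim A) (V := (homothety c @: W)%VS)
    ltac:(by rewrite limg_dim_eq // (eqP (lker_homothety c0)) capv0).
  have /row_span_eqmx eN : row_span (MA + c *: MB) = row_span N.
    by rewrite -imgM NE.
  by rewrite /row_free eN.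
by move=> /filter_ex[c [c0 Oc]]; exists c => //; exact: OU.
Unshelve. all: by end_near. Qed.

(** Shrink [W] by a homothety into the basin of attraction of [A].  The homothety
    commutes with [h], so the iterates of [W] are images of the iterates of the
    shrunk space under the inverse homothety, which is continuous and fixes
    [A]. *)
Lemma attracting_complement (h : 'End(E)) (W : {vspace E}) (O : set (Grass E)) :
  (h @: A <= A)%VS -> (h @: B <= B)%VS ->
  attracting_fixed_point (fun V : Grass E => (h @: V)%VS : Grass E) A ->
  \dim W = \dim A -> (W :&: B = 0)%VS -> nbhs (A : Grass E) O ->
  \forall n \near \oo, O (iter n (fun V : Grass E => (h @: V)%VS : Grass E) W).
Proof.
move=> hA hB [_ [U nU attrU]] dimW WB0 nO.
have [c c0 UW] := homothety_cvg dimW WB0 nU.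
set f := fun V : Grass E => _.
have c'0 : c^-1 != 0 by rewrite invr_eq0.
have iterC n V c' : (homothety c' @: iter n f V = iter n f (homothety c' @: V))%VS.
  elim: n => //= n IHn; rewrite /f -[RHS]/(h @: _)%VS -IHn -!limg_comp.
  by rewrite homothety_comm.
have nO' : nbhs (A : Grass E) ((fun V : Grass E => (homothety c^-1 @: V)%VS : Grass E) @^-1` O).
  apply: (Grass_img_continuous (lker_homothety c'0)).
  by rewrite homothety_img.
have := attrU _ nO'; apply: filterS => n sub.
have /= := sub _ (imageP _ UW); rewrite iterC -limg_comp.
suff -> : (homothety c^-1 \o homothety c)%VF = \1%VF by rewrite lim1g.
by apply/lfunP => v; rewrite comp_lfunE homothetyK // id_lfunE.
Qed.

End Attractor.

(** * Dynamics on the Gromov boundary *)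

Section BoundaryAction.
Variable G : hyperbolicGroup.
Local Notation len := (word_length (hyp_gens G)).
Local Notation gp := (gromov_product (hyp_gens G)).
Let gen : generates (hyp_gens G) := @hyp_generates G.

Lemma boundary_act1 (x : boundary G) : boundary_act 1%g x = x.
Proof.
elim/quotP: x => u _; rewrite boundary_actE; congr (\pi_(boundary G) _).
by apply: val_inj; apply: funext => n /=; rewrite mul1g.
Qed.

Lemma boundary_actM (g h : G) (x : boundary G) :
  boundary_act (g * h)%g x = boundary_act g (boundary_act h x).
Proof.
elim/quotP: x => u _; rewrite !boundary_actE; congr (\pi_(boundary G) _).
by apply: val_inj; apply: funext => n /=; rewrite mulgA.
Qed.

Lemma boundary_actK (g : G) : cancel (boundary_act g) (boundary_act g^-1%g).
Proof. by move=> x; rewrite -boundary_actM mulVg boundary_act1. Qed.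

Lemma gromov_product_translate (g a b : G) :
  gp a b - (len g)%:R <= gp (g * a)%g (g * b)%g.
Proof.
rewrite /gromov_product.
have -> : ((g * a)^-1 * (g * b) = a^-1 * b)%g.
  by rewrite invgM mulgA -(mulgA a^-1%g) mulVg mulg1.
have H w : (len w)%:R <= (len g)%:R + (len (g * w)%g)%:R :> rat.
  rewrite -natrD ler_nat -[w in leqLHS](mulKg g) -(word_lengthV g gen).
  exact: word_lengthM.
by have := H a; have := H b; lra.
Qed.

Lemma boundary_act_continuous (g : G) : continuous (boundary_act g).
Proof.
apply/continuousP => O oO.
change (boundary_open (boundary_act g @^-1` O)) => x Ogx.
have [r sub] : exists r, shadow (boundary_act g x) r `<=` O by exact: oO.
exists (r + (len g)%:R) => y [u [v [ux vy [N HN]]]]; apply: sub.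
exists (translate g u), (translate g v); split; rewrite -?boundary_actE ?ux ?vy //.
exists N => m n mN nN; apply: le_trans (gromov_product_translate _ _ _).
by rewrite lerBrDr HN.
Qed.

Lemma gromov_product_mul (w a : G) : gp w (w * a)%g = (len w)%:R - gp w^-1%g a.
Proof.
by rewrite /gromov_product mulKg invgK (word_lengthV _ gen); lra.
Qed.

Lemma gromov_product_diag (a : G) : gp a a = (len a)%:R.
Proof.
rewrite /gromov_product mulVg.
have -> : len 1%g = 0%N.
  apply/eqP; rewrite -leqn0; apply: word_length_le.
  by exists [::]; split => //; rewrite big_nil.
by lra.
Qed.

Lemma hyp_slim_ge0 : exists2 delta : rat, 0 <= delta & forall x y z : G,
  Num.min (gp x y) (gp y z) - delta <= gp x z.
Proof.
have [delta slim] := hyp_slim G; exists (Num.max delta 0).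
  by rewrite le_max lexx orbT.
move=> x y z; apply: le_trans (slim x y z).
by rewrite lerB // le_max lexx.
Qed.

(** Let w be a far term of a sequence converging to [x].  The Gromov product of w and
    w a is the length of w minus the product of the inverse of w and a.  The
    inverse of w cannot be close to both [p] and [q], so w moves one of them
    close to w, hence close to [x]. *)
Lemma orbits_dense (p q x : boundary G) (O : set (boundary G)) :
  p <> q -> nbhs x O ->
  exists h : G, O (boundary_act h p) \/ O (boundary_act h q).
Proof.
rewrite nbhsE => pq [B [oB Bx] BO].
have [r sub] : exists r, shadow x r `<=` B by exact: oB.
have [delta delta0 slim] := hyp_slim_ge0.
move: pq sub {Bx oB}; elim/quotP: x => u _; elim/quotP: p => a _; elim/quotP: q => b _.
move=> pq sub.
have [r0 nfar] : exists r0, ~ eventually_ge r0 (val a) (val b).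
  apply/existsNP => ab; apply: pq; apply/eqmodP; exact/asboolP.
(* Distinct boundary points have representatives with bounded products along a
   cofinal set of pairs of indices. *)
have far N : exists m n, [/\ (N <= m)%N, (N <= n)%N & gp (val a m) (val b n) < r0].
  apply: contrapT => nex; apply: nfar; exists N => m n mN nN.
  by rewrite leNgt; apply/negP => lt_r0; apply: nex; exists m, n.
pose R1 := r + delta + delta.
have uu : fellow (val u) (val u) by exact: asboolW (valP u).
have [N1 HN1] := uu R1; have [N2 HN2] := uu (R1 + r0 + delta).
set n0 := maxn N1 N2; pose w := val u n0.
have w_long : R1 + r0 + delta <= (len w)%:R.
  by rewrite -gromov_product_diag HN2 // leq_maxr.
have enough (c : gseq G) : (forall N, exists2 m, (N <= m)%N & R1 <= gp w (w * val c m)%g) ->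
    O (boundary_act w (\pi_(boundary G) c)).
  move=> inf; apply: BO; apply: sub; exists u, (translate w c).
  rewrite boundary_actE; split => //.
  have cc : fellow (val c) (val c) by exact: asboolW (valP c).
  have [N3 HN3] := fellow_translate w cc R1.
  have [m0 m0N3 Hm0] := inf N3.
  exists (maxn N1 N3) => m n; rewrite !geq_max => /andP[mN1 _] /andP[_ nN3].
  apply: le_trans (slim _ w _); rewrite lerBrDr le_min.
  apply/andP; split.
    by apply: le_trans (HN1 _ _ mN1 (leq_maxl N1 N2)); rewrite /R1; lra.
  apply: le_trans (slim _ (w * val c m0)%g _); rewrite lerBrDr le_min.
  by apply/andP; split; [apply: le_trans Hm0 | apply: le_trans (HN3 _ _ m0N3 nN3)]; rewrite /R1; lra.
(* For each such pair, w moves one of the two points towards itself. *)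
have near_w m n : gp (val a m) (val b n) < r0 ->
    R1 <= gp w (w * val a m)%g \/ R1 <= gp w (w * val b n)%g.
  move=> lt_r0; rewrite !gromov_product_mul.
  have := slim (val a m) (w^-1)%g (val b n).
  rewrite (gromov_productC (val a m)) //.
  case: (leP (gp w^-1 (val a m)) (gp w^-1 (val b n)))%g => _ H; [left|right]; lra.
exists w; have [infa|/existsNP[Na fina]] := pselect
    (forall N, exists2 m, (N <= m)%N & R1 <= gp w (w * val a m)%g).
  by left; exact: enough.
right; apply: enough => N; have [m [n [mN nN lt_r0]]] := far (maxn N Na).
have [Ha|Hb] := near_w m n lt_r0.
  by case: fina; exists m => //; apply: leq_trans mN; exact: leq_maxr.
by exists n => //; apply: leq_trans nN; exact: leq_maxl.
Qed.

End BoundaryAction.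

(** A point y of both basins, distinct from [p], would be pushed towards [p] by
    the inverse map [g] and then brought back to y by [f], while [f] moves the
    basin away from y. *)
Lemma attracting_inverse (T : topologicalType) (f g : T -> T) (p : T) :
  cancel g f -> attracting_fixed_point f p -> attracting_fixed_point g p ->
  (forall y, y <> p -> nbhs p (~` [set y])) ->
  (forall U, nbhs p U -> exists2 y, U y & y <> p) -> False.
Proof.
move=> gK [_ [U nU attrU]] [_ [V nV attrV]] T1 nisol.
have [y [Uy Vy] yp] := nisol _ (filterI nU nV).
have [n [subU subV]] := filter_ex (filterI (attrU _ (T1 _ yp)) (attrV _ nU)).
have gnU : U (iter n g y) by apply: subV; exists y.
have iterK : iter n f (iter n g y) = y.
  elim: n {subU subV gnU} => //= n IHn.
  by rewrite -iterS iterSr gK IHn.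
by case: (subU _ (imageP _ gnU)).
Qed.

(** The additive group of the integers, with the multiplicative notation used for
    surface groups. *)
Definition int_group := int.
HB.instance Definition _ := Choice.on int_group.
HB.instance Definition _ := isGroup.Build int_group
  (@addrA int) (@add0r int) (@addr0 int) (@addNr int) (@addrN int).

(** Sending all a_i to 1 and all b_i to 0 respects the relator, because the group
    of integers is commutative. *)
Lemma surface_group_infinite_order (G : hyperbolicGroup) :
  surface_group G -> exists g : G, infinite_order g.
Proof.
move=> [g [a [b [g2 _ univ]]]].
pose one : int_group := 1%R : int.
have [|f [[fM fa _] _]] := univ int_group (fun=> one) (fun=> 1%g).
  by rewrite /surface_relator big1 // => i _; rewrite invg1 !mulg1 mulgV.
exists (a (Ordinal (ltnW g2))) => n n0 an1.
have f1 : f 1%g = 1%g.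
  by have := fM 1%g 1%g; rewrite mulg1 => /(congr1 (mulg (f 1%g)^-1%g)); rewrite mulVg mulKg.
have fX x m : f (x ^+ m)%g = (f x ^+ m)%g.
  by elim: m => [|m IHm]; rewrite ?expg0 ?f1 // !expgS fM IHm.
have : f (a (Ordinal (ltnW g2)) ^+ n)%g = 1%g by rewrite an1.
rewrite fX fa.
have -> : (one ^+ n)%g = n%:Z :> int.
  by elim: n {n0 an1} => //= n IHn; rewrite expgS -addn1 addnC PoszD -IHn.
by move=> /eqP; rewrite -[1%g]/(0%Z : int) eqz_nat => /eqP n00; move: n0; rewrite n00.
Qed.

Lemma infinite_orderV (G : hyperbolicGroup) (g : G) :
  infinite_order g -> infinite_order g^-1%g.
Proof.
by move=> inf n n0; rewrite expgVn => /(congr1 (@invg _)); rewrite invgK invg1; exact: inf.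
Qed.

(** * Cyclic order of boundary points *)

Section CircleCoordinates.
Variable R : realType.

Lemma circle_angle (a b : R) : a ^+ 2 + b ^+ 2 = 1 ->
  exists t, [/\ - pi <= t, t <= pi, a = cos t & b = sin t].
Proof.
move=> ab1.
have a1 : -1 <= a <= 1.
  rewrite -ler_norml -(@ler_pXn2r _ 2) ?nnegrE // expr1n real_normK ?num_real //.
  by rewrite -ab1 lerDl sqr_ge0.
have sb : sin (acos a) = `|b|.
  by rewrite sin_acos // -ab1 addrC addKr sqrtr_sqr.
have [b0|b0] := leP 0 b.
  exists (acos a); rewrite acos_lepi // acosK ?in_itv //= sb ger0_norm //.
  by split => //; rewrite (le_trans _ (acos_ge0 a1)) // oppr_le0 pi_ge0.
exists (- acos a); rewrite lerN2 acos_lepi // cosN sinN acosK ?in_itv //= sb ltr0_norm // opprK.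
by split => //; rewrite (le_trans _ (pi_ge0 R)) // oppr_le0 acos_ge0.
Qed.

(** Rotate by the angle [t0] before choosing the angle. *)
Lemma circle_angle_from (z : R * R) (t0 : R) : unit_circle z ->
  exists t, [/\ - pi <= t, t <= pi, z = (cos (t0 + t), sin (t0 + t)) &
    cos t = z.1 * cos t0 + z.2 * sin t0].
Proof.
case: z => a b; rewrite /unit_circle /= => ab1.
have [|t [t1 t2 ct st]] := @circle_angle (a * cos t0 + b * sin t0) (b * cos t0 - a * sin t0).
  have := cos2Dsin2 t0; move: (cos t0) (sin t0) => c s cs.
  transitivity ((a ^+ 2 + b ^+ 2) * (c ^+ 2 + s ^+ 2)); first by ring.
  by rewrite ab1 cs mulr1.
exists t; split => //; rewrite cosD sinD -ct -st.
have := cos2Dsin2 t0; move: (cos t0) (sin t0) => c s cs.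
have -> : c * (a * c + b * s) - s * (b * c - a * s) = a * (c ^+ 2 + s ^+ 2) by ring.
have -> : s * (a * c + b * s) + c * (b * c - a * s) = b * (c ^+ 2 + s ^+ 2) by ring.
by rewrite cs !mulr1.
Qed.

End CircleCoordinates.

Section CircleOrder.
Variables (R : realType) (T : topologicalType) (phi : T -> R * R).
Hypothesis hphi : homeo_circle phi.

Lemma homeo_circle_inj : injective phi.
Proof. by have [_ _ [psi phiK _]] := hphi; exact: can_inj phiK. Qed.

Lemma homeo_circle_on y : unit_circle (phi y).
Proof. by have [_ <- _] := hphi; exists y. Qed.

Lemma homeo_circle_point t : exists y, phi y = (cos t, sin t).
Proof.
have [_ im _] := hphi; have : unit_circle (cos t, sin t) by exact: cos2Dsin2.
by rewrite -im => -[y _ phiy]; exists y.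
Qed.

Lemma homeo_circle_angle x : exists t, phi x = (cos t, sin t).
Proof.
have [t [_ _ -> _]] := circle_angle_from 0 (homeo_circle_on x).
by exists (0 + t).
Qed.

(** The difference of the angles has cosine 1, which within a full turn forces it
    to be 0 or a full turn. *)
Lemma angle_sep (a b : R) : (cos a, sin a) = (cos b, sin b) ->
  ~ (a < b < a + 2 * pi).
Proof.
move=> [ca sa] /andP[ab ba]; have pi0 : 0 < pi :> R := pi_gt0 R.
have c1 : cos (b - a) = 1 by rewrite cosB -ca -sa -!expr2 cos2Dsin2.
have [le_pi|gt_pi] := leP (b - a) pi.
  move: c1; rewrite -cos0 => /cos_inj h; have : b - a = 0.
    by apply: h; rewrite in_itv /= ?lexx ?pi_ge0 //; lra.
  by lra.
have : cos (pi *+ 2 - (b - a)) = 1.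
  by rewrite addrC cosD2pi cosN.
rewrite -cos0 => /cos_inj h; have : pi *+ 2 - (b - a) = 0.
  by apply: h; rewrite in_itv /= ?lexx ?pi_ge0 // mulr2n; lra.
by rewrite mulr2n; lra.
Qed.

Lemma cos_norm_lt (a delta : R) : 0 <= delta <= pi -> - pi <= a <= pi ->
  cos delta < cos a -> `|a| < delta.
Proof.
move=> /andP[d0 dpi] api lt_cos; rewrite ltNge; apply/negP => le_d.
suff : cos `|a| <= cos delta by rewrite cos_norm leNgt lt_cos.
have [e|ne] := eqVneq delta `|a|; first by rewrite -e lexx.
apply: ltW; rewrite ltr_cos ?in_itv /= ?normr_ge0 ?d0 ?dpi ?ler_norml //.
by rewrite lt_neqAle ne.
Qed.

(** The cosine of the angle with [x] is the scalar product with [phi x], hence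
    continuous, and it exceeds cos delta only for angles smaller than delta. *)
Lemma homeo_circle_near (x : T) t0 (delta : R) : phi x = (cos t0, sin t0) ->
  0 < delta <= pi ->
  \forall y \near x, exists2 a, `|a| < delta & phi y = (cos (t0 + a), sin (t0 + a)).
Proof.
move=> phix /andP[d0 dpi]; have [cphi _ _] := hphi.
pose f y := (phi y).1 * cos t0 + (phi y).2 * sin t0.
have cf : f @ x --> f x.
  apply: cvgD; apply: cvgM; try exact: cvg_cst.
    by apply: (@cvg_comp _ _ _ phi fst); [exact: cphi | exact: cvg_fst].
  by apply: (@cvg_comp _ _ _ phi snd); [exact: cphi | exact: cvg_snd].
have fx : f x = 1 by rewrite /f phix /= -!expr2 cos2Dsin2.
have lt_f : cos delta < f x.
  rewrite fx -cos0 ltr_cos // ?in_itv /= ?lexx ?pi_ge0 ?(ltW d0) //.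
have : \forall y \near x, cos delta < f y by apply: (cvgr_gt (f x)).
apply: filterS => y lt_y.
have [a [a1 a2 phiy cosa]] := circle_angle_from t0 (homeo_circle_on y).
exists a => //; apply: cos_norm_lt; rewrite ?(ltW d0) ?a1 //.
by rewrite cosa.
Qed.

Lemma homeo_circle_t1 (x y : T) : y <> x -> nbhs x (~` [set y]).
Proof.
move=> yx; have [cphi _ _] := hphi.
have nphi : nbhs (phi x) (~` [set phi y]).
  apply: open_nbhs_nbhs; split.
    apply: closed_openC.
    have hR : hausdorff_space (R * R)%type by exact: norm_hausdorff.
    exact: (accessible_closed_set1 (hausdorff_accessible hR)).
  by move=> /= /homeo_circle_inj /esym.
have ev : \forall z \near x, phi z <> phi y := cphi x _ nphi.
by apply: filterS ev => z zy /= zE; apply: zy; rewrite zE.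
Qed.

Lemma homeo_circle_continuous_inv (x : T) t0 (U : set T) : phi x = (cos t0, sin t0) ->
  nbhs x U -> \forall t \near t0, forall y, phi y = (cos t, sin t) -> U y.
Proof.
move=> phix nU; have [_ _ [psi phiK cpsi]] := hphi.
have psiz : psi (cos t0, sin t0) = x by rewrite -phix phiK.
have := (@subspace_continuousP _ (@unit_circle R) _ psi).1 cpsi (cos t0, sin t0) (cos2Dsin2 t0).
rewrite psiz => /(_ U nU) ev.
have cz : (cos t, sin t) @[t --> t0] --> (cos t0, sin t0).
  apply: (@cvg_pair _ _ _ (nbhs t0) (nbhs (cos t0)) (nbhs (sin t0))).
    exact: continuous_cos.
  exact: continuous_sin.
have ev' : \forall t \near t0, unit_circle (cos t, sin t) -> U (psi (cos t, sin t)).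
  exact: cz _ ev.
apply: filterS ev' => t h y phiy.
by have := h (cos2Dsin2 t); rewrite -phiy phiK.
Qed.

Lemma homeo_circle_not_isolated (x : T) (U : set T) :
  nbhs x U -> exists2 y, U y & y <> x.
Proof.
move=> nU; have [t0 phix] := homeo_circle_angle x.
have ev := homeo_circle_continuous_inv phix nU.
near t0^'+ => t.
have Ut : forall y, phi y = (cos t, sin t) -> U y by near: t; exact: cvg_within ev.
have lt_t : t0 < t by near: t; exact: nbhs_right_gt.
have t_lt : t < t0 + pi by near: t; apply: nbhs_right_lt; rewrite ltrDl pi_gt0.
have [y phiy] := homeo_circle_point t.
have pi0 : 0 < pi :> R := pi_gt0 R.
exists y; first exact: Ut.
by move=> yx; move: phiy; rewrite yx phix => /angle_sep; apply; lra.
Unshelve. all: by end_near. Qed.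

Lemma homeo_circle_after x t0 y : phi x = (cos t0, sin t0) -> y <> x ->
  exists2 t, 0 < t < 2 * pi & phi y = (cos (t0 + t), sin (t0 + t)).
Proof.
move=> phix yx; have [t [t1 t2 phiy _]] := circle_angle_from t0 (homeo_circle_on y).
have pi0 : 0 < pi :> R := pi_gt0 R.
have [t_lt|t_gt|t_eq] := ltgtP t 0.
- exists (t + pi *+ 2); first by rewrite mulr2n; lra.
  by rewrite phiy addrA cosD2pi sinD2pi.
- by exists t => //; lra.
by case: yx; apply: homeo_circle_inj; rewrite phiy t_eq addr0 phix.
Qed.

(** Measure angles from [x], so that the points of [ys] lie strictly between 0 and
    a full turn, at distance at least eps from both ends, and sort them.  The
    auxiliary point [s] has angle eps / 2 and [t] has angle smaller than eps / 2
    in absolute value, so [t] comes before [s] and after the last point, whichever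
    side of [x] it lies on. *)
Lemma cyclic_order (x : T) (ys : seq T) : uniq ys -> x \notin ys ->
  exists (ys' : seq T) (s : T),
    [/\ perm_eq ys' ys, s <> x, s \notin ys &
      \forall t \near x, t <> s /\ t \notin ys /\
        positively_oriented phi
          (fun i : 'I_(size ys').+2 => nth x [:: t, s & ys'] i)].
Proof.
move=> uys xys; have [t0 phix] := homeo_circle_angle x.
have pi0 : 0 < pi :> R := pi_gt0 R.
have /choice[tau tauP] : forall y, exists t, y <> x ->
    0 < t < 2 * pi /\ phi y = (cos (t0 + t), sin (t0 + t)).
  move=> y; have [->|/eqP yx] := eqVneq y x; first by exists 0.
  by have [t ? ?] := homeo_circle_after phix yx; exists t.
have ysx y : y \in ys -> y <> x by move=> yys yx; move: xys; rewrite -yx yys.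
have [eps [eps0 epspi epsP]] : exists eps : R, [/\ 0 < eps, eps <= pi &
    forall y, y \in ys -> eps <= tau y <= 2 * pi - eps].
  elim: ys ysx {uys xys} => [|y ys IHys] ysx; first by exists pi.
  have [|eps [eps0 epspi epsP]] := IHys.
    by move=> z zys; apply: ysx; rewrite inE zys orbT.
  have [tau_y _] := tauP y (ysx y (mem_head _ _)).
  exists (Num.min eps (Num.min (tau y) (2 * pi - tau y))); split.
  - by rewrite !lt_min; lra.
  - by rewrite ge_min epspi.
  move=> z; rewrite inE => /orP[/eqP ->|/epsP].
    have : Num.min eps (Num.min (tau y) (2 * pi - tau y)) <= tau y.
      by rewrite !ge_min lexx !orbT.
    have : Num.min eps (Num.min (tau y) (2 * pi - tau y)) <= 2 * pi - tau y.
      by rewrite !ge_min lexx !orbT.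
    by lra.
  have : Num.min eps (Num.min (tau y) (2 * pi - tau y)) <= eps.
    by rewrite !ge_min lexx.
  by lra.
have [s phis] := homeo_circle_point (t0 + eps / 2).
pose le_tau := [rel y z | tau y <= tau z].
have le_tau_tot : total le_tau by move=> y z; exact: le_total.
have le_tau_trans : transitive le_tau by move=> y z w; exact: le_trans.
exists (sort le_tau ys), s.
have sysE y : (y \in sort le_tau ys) = (y \in ys) by rewrite mem_sort.
have eps2 : 0 < eps / 2 <= pi by lra.
have s_ys : s \notin ys.
  apply/negP => sys; have [_ phis'] := tauP s (ysx s sys).
  have := epsP s sys; move: phis'; rewrite phis => /angle_sep h ?; apply: h; lra.
split => //.
- by rewrite perm_sort.
- move=> sx; move: phis; rewrite sx phix => /angle_sep; apply; lra.
have := homeo_circle_near phix eps2; apply: filterS => t [a a_lt phit].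
move: a_lt; rewrite ltr_norml => /andP[a1 a2].
split; first by move=> ts; move: phis; rewrite -ts phit => /angle_sep; apply; lra.
split.
  apply/negP => tys; have [_ phit'] := tauP t (ysx t tys).
  have := epsP t tys; move: phit'; rewrite phit => /angle_sep h ?; apply: h; lra.
pose thetas := [:: a, eps / 2 & map tau (sort le_tau ys)].
have size_thetas : size thetas = (size (sort le_tau ys)).+2 by rewrite /= size_map.
have in_thetas (j : 'I_(size (sort le_tau ys)).+2) : thetas`_j \in thetas.
  by rewrite mem_nth // size_thetas.
have thetas_bd b : b \in thetas -> a <= b < a + 2 * pi.
  rewrite !inE => /or3P[/eqP ->|/eqP ->|/mapP[y yin ->]]; [by lra|by lra|].
  by have := epsP y; rewrite -sysE yin => /(_ isT); lra.
have sorted_thetas : sorted <%R thetas.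
  rewrite /= (path_sortedE lt_trans); apply/and3P; split => //.
    by apply/allP => _ /mapP[y yin ->] /=; have := epsP y; rewrite -sysE yin => /(_ isT); lra.
  rewrite lt_sorted_uniq_le; apply/andP; split; last first.
    by rewrite sorted_map; exact: sort_sorted.
  rewrite map_inj_in_uniq ?sort_uniq // => y z; rewrite !sysE => yys zys tau_yz.
  have [_ phiy] := tauP y (ysx y yys); have [_ phiz] := tauP z (ysx z zys).
  by apply: homeo_circle_inj; rewrite phiy phiz tau_yz.
exists (fun j => t0 + thetas`_j); split.
- move=> [[|[|j]] lt_j] //=.
  have jys : (j < size (sort le_tau ys))%N by [].
  rewrite (nth_map x) //.
  by have [] := tauP _ (ysx _ (etrans (esym (sysE _)) (mem_nth x jys))).
- move=> i j ij; rewrite ltrD2l.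
  by rewrite (lt_sorted_ltn_nth 0 sorted_thetas) // inE size_thetas.
- move=> i j.
  have := thetas_bd _ (in_thetas i); have := thetas_bd _ (in_thetas j); lra.
Qed.

End CircleOrder.

(** * Limit maps of k-positive representations *)

Section KPositive.
Variables (R : realType) (G : hyperbolicGroup) (E : vectType R).
Variables (rho : {multiplicative G -> PGL E}) (k : nat) (phi : boundary G -> R * R).
Variable xi : nat -> boundary G -> Grass E.
Hypotheses (hG : surface_group G) (hphi : homeo_circle phi).
Hypotheses (hrho : k_positive rho phi k) (hxi : limit_maps rho k xi).
Local Notation d := (\dim {:E}).
Local Notation e := (vbasis {:E}).
Let e_basis : basis_of {:E} e := vbasisP fullv.

Lemma limit_anosov j : (0 < j <= k)%N -> anosov_maps rho j (xi j) (xi (d - j)%N).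
Proof. by case: hxi => h _ _; exact: h. Qed.

Lemma k_gt0 : (0 < k)%N.
Proof. by case: hrho. Qed.

Lemma k_ltd : (k < d)%N.
Proof. by have [/andP[]] := @limit_anosov k ltac:(by rewrite k_gt0 leqnn). Qed.

Lemma limit_map0 x : xi 0%N x = 0%VS.
Proof. by case: hxi. Qed.

Lemma limit_dim j x : (j <= k)%N -> \dim (xi j x) = j.
Proof.
case: j => [|j] jk; first by rewrite limit_map0 dimv0.
by have [] := @limit_anosov j.+1 jk.
Qed.

Lemma limit_codim j x : (0 < j <= k)%N -> \dim (xi (d - j)%N x) = (d - j)%N.
Proof. by move=> /limit_anosov[]. Qed.

Lemma limit_transverse j x y : (0 < j <= k)%N -> x <> y ->
  transverse (xi j x) (xi (d - j)%N y).
Proof. by move=> /limit_anosov[_ _ _ _ _ + _ _]; apply. Qed.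

Lemma limit_equivariant j : (j <= k)%N -> equivariant rho (xi j).
Proof.
case: j => [|j] jk; last by have [_ _ _ []] := @limit_anosov j.+1 jk.
by move=> g x; rewrite !limit_map0 /PGL_act limg0.
Qed.

Lemma limit_coequivariant j : (0 < j <= k)%N -> equivariant rho (xi (d - j)%N).
Proof. by move=> /limit_anosov[_ _ _ []]. Qed.

Lemma quot_proj_full (U V : {vspace E}) :
  (quot_proj U @: V)%VS = fullv -> (V + U)%VS = fullv.
Proof.
move=> full; apply/vspaceP => v; rewrite memvf.
have : quot_proj U v \in (quot_proj U @: V)%VS by rewrite full memvf.
move=> /memv_imgP[w wV vw]; rewrite -[v](subrK w) addrC memv_add //.
have : v - w \in lker (quot_proj U) by rewrite memv_ker linearB /= vw subrr.
by rewrite quot_proj_ker.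
Qed.

Lemma positive_quot x n (p : 'I_n -> boundary G) : (2 <= k)%N -> (3 <= n)%N ->
  (forall i, p i <> x) -> positively_oriented phi p ->
  positive_tuple (fun i => pi_quot k xi x (p i)).
Proof.
by move=> k2 n3 px op; have [_ _ /(_ k2 _ hxi x)[+ _]] := hrho; apply.
Qed.

(** Finite sets are closed in the circle. *)
Lemma near_not_mem (x : boundary G) (ys : seq (boundary G)) : x \notin ys ->
  \forall y \near x, y \notin ys.
Proof.
elim: ys => [|z ys IHys]; first by move=> _; near=> y; rewrite in_nil.
rewrite inE negb_or => /andP[/eqP xz /IHys ev].
have ev' : \forall y \near x, y <> z by apply: (homeo_circle_t1 hphi) => zx; apply: xz.
near=> y; rewrite inE negb_or; apply/andP; split; last by near: y.
by apply/eqP; near: y.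
Unshelve. all: by end_near. Qed.

Lemma fresh_point (x : boundary G) (ys : seq (boundary G)) : x \notin ys ->
  exists z, z <> x /\ z \notin ys.
Proof.
move=> xys; have [z zys zx] := homeo_circle_not_isolated hphi (near_not_mem xys).
by exists z.
Qed.

Lemma sum_le_mem (ys : seq (boundary G)) (n : boundary G -> nat) y :
  y \in ys -> (n y <= \sum_(z <- ys) n z)%N.
Proof. by move=> yys; rewrite (big_rem y) //= leq_addr. Qed.

(** If some multiplicity equals [k], this is transversality.  Otherwise all
    multiplicities are smaller than [k], so that the corresponding spaces are
    pieces of the flags in E / x^(d-k), where positivity puts them in general
    position. *)
Lemma span_at_codim_k x ys (n : boundary G -> nat) :
  uniq ys -> x \notin ys -> (\sum_(y <- ys) n y)%N = k ->
  (\sum_(y <- ys) xi (n y) y + xi (d - k)%N x)%VS = fullv.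
Proof.
move=> uys xys sum_n.
have [/hasP[y yys yk]|no_k] := boolP (has (fun y => k <= n y)%N ys).
  have yE : n y = k by apply/eqP; rewrite eqn_leq yk -sum_n sum_le_mem.
  apply/eqP; rewrite eqEsubv subvf /= (big_rem y) //= yE.
  have yx : y <> x by move=> yx; move: xys; rewrite -yx yys.
  have kk : (0 < k <= k)%N by rewrite k_gt0 leqnn.
  have [_ full] := limit_transverse kk yx.
  apply: subv_trans (_ : (xi k y + xi (d - k)%N x <= _)%VS); first by rewrite full.
  by apply: addvS; rewrite ?addvSl ?subvv.
have {}no_k y : y \in ys -> (n y < k)%N.
  by move=> yys; rewrite ltnNge; apply/negP => le; move/hasPn: no_k => /(_ y yys); rewrite le.
have [y0 y0ys n0] : exists2 y, y \in ys & (0 < n y)%N.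
  apply: contrapT => none; have := k_gt0; rewrite -sum_n big_seq big1 // => y yys.
  by apply/eqP; rewrite -leqn0 leqNgt; apply/negP => ny; apply: none; exists y.
have k2 : (2 <= k)%N by apply: leq_ltn_trans (no_k _ y0ys).
have [ys' [s [permys sx sys near_x]]] := cyclic_order hphi uys xys.
have [t [ts [tys orient]] tx] := homeo_circle_not_isolated hphi near_x.
have memys y : (y \in ys') = (y \in ys) by rewrite (perm_mem permys).
(* The two auxiliary points, which make the tuple long enough, get multiplicity
   0. *)
pose n' y := if y \in ys then n y else 0%N.
pose p (i : 'I_(size ys').+2) := nth x [:: t, s & ys'] i.
have px i : p i <> x.
  have : p i \in [:: t, s & ys'] by rewrite mem_nth.
  rewrite !inE memys => /or3P[/eqP ->|/eqP ->|] // pys px.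
  by move: xys; rewrite -px pys.
have size_ys' : (0 < size ys')%N by rewrite (perm_size permys); case: (ys) y0ys.
have pos := @positive_quot x _ p k2 ltac:(by rewrite !ltnS) px orient.
have kk : (0 < k <= k)%N by rewrite k_gt0 leqnn.
have dimX : \dim {:quot_space (xi (d - k)%N x)} = k.
  by rewrite dim_quot_space limit_codim // subKn // ltnW // k_ltd.
have sum_p (V : Type) (idx : V) (op : Monoid.com_law idx) (F : boundary G -> V) :
    \big[op/idx]_i F (p i) = op (F t) (op (F s) (\big[op/idx]_(y <- ys) F y)).
  rewrite -(perm_big _ permys) /=.
  have -> : \big[op/idx]_i F (p i) = \big[op/idx]_(y <- [:: t, s & ys']) F y.
    by rewrite (big_nth x) big_mkord.
  by rewrite !big_cons.
have n't : n' t = 0%N by rewrite /n' (negPf tys).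
have n's : n' s = 0%N by rewrite /n' (negPf sys).
have := positive_tuple_span (n := fun i => n' (p i)) pos.
rewrite dimX => full; apply: quot_proj_full; rewrite limg_sum -{}full //.
- rewrite (sum_p _ _ _ (fun y => pi_quot k xi x y (n' y))) /= n't n's.
  rewrite /pi_quot !limit_map0 limg0 !add0v !big_seq.
  by apply: eq_bigr => y yys; rewrite /n' yys.
- by move=> i; rewrite /pi_quot limit_map0 limg0.
- move=> i; rewrite /n'; case: ifP => [|_]; [exact: no_k | exact: k_gt0].
- rewrite (sum_p _ _ _ n') /= n't n's !add0n -[RHS]sum_n !big_seq.
  by apply: eq_bigr => y yys; rewrite /n' yys.
Qed.


Lemma PGL_act_add (g : PGL E) (V W : {vspace E}) :
  PGL_act g (V + W)%VS = (PGL_act g V + PGL_act g W)%VS.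
Proof. exact: limgD. Qed.

Lemma lker_PGL_lift (g : PGL E) : lker (PGL_lift g) == 0%VS.
Proof. exact: (valP (generic_quotient.repr g)). Qed.

Lemma span_two_at_codim_k k' x y z : (0 < k' < k)%N -> y <> z -> y <> x -> z <> x ->
  (xi (k - k')%N y + xi k' z + xi (d - k)%N x)%VS = fullv.
Proof.
move=> /andP[k'0 k'k] yz yx zx.
have yz' : (y == z) = false by apply/eqP.
have zy' : (z == y) = false by rewrite eq_sym.
have := @span_at_codim_k x [:: y; z] (fun w => if w == y then (k - k')%N else k').
rewrite !big_cons !big_nil eqxx zy' addn0 addv0; apply.
- by rewrite /= inE yz'.
- by rewrite !inE; apply/norP; split; apply/eqP => /esym.
- by rewrite subnK // ltnW.
Qed.

(** The point t is an iterate of a point s of the basin of [p]: since p^(d-k) is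
    invariant, the spaces t^c + p^(d-k) are the iterates of s^c + p^(d-k), which
    is a complement of q^(k'). *)
Lemma attracted_pair k' p q (g : G) : (0 < k' < k)%N ->
  attracting_fixed_point (boundary_act g) p ->
  attracting_fixed_point (PGL_act (rho g)) (xi (d - k')%N p) ->
  boundary_act g q = q -> q <> p ->
  forall (N : set (boundary G)) (O : set (Grass E)),
    nbhs p N -> nbhs (xi (d - k')%N p) O ->
  exists t, [/\ N t, t <> p & O (xi (k - k')%N t + xi (d - k)%N p)%VS].
Proof.
move=> k'P [gp [U nU attrU]] attrP gq qp N O nN nO.
have /andP[k'0 k'k] := k'P.
have kd := k_ltd.
have [s [Us sq] sp] := homeo_circle_not_isolated hphi
  (filterI nU (homeo_circle_t1 hphi qp)).
pose W : {vspace E} := (xi (k - k')%N s + xi (d - k)%N p)%VS.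
have k'kk : (0 < k' <= k)%N by rewrite k'0 ltnW.
have [AB0 ABE] := limit_transverse k'kk qp.
have WB : (W + xi k' q)%VS = fullv.
  rewrite /W -addvA [X in (_ + X)%VS]addvC addvA.
  by apply: span_two_at_codim_k => //.
have dimB : \dim (xi k' q) = k' by rewrite limit_dim // ltnW.
have dimW_le : (\dim W <= d - k')%N.
  apply: leq_trans (dimv_add_leqif _ _) _.
  by rewrite limit_dim ?leq_subr // limit_codim ?k_gt0 ?leqnn //; lia.
have := dimv_sum_cap W (xi k' q); rewrite WB dimB => dims.
have WB0 : (W :&: xi k' q = 0)%VS by apply/eqP; rewrite -dimv_eq0; apply/eqP; lia.
have dimW : \dim W = \dim (xi (d - k')%N p).
  by rewrite limit_codim //; move: dims; rewrite WB0 dimv0; lia.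
have hA : (PGL_lift (rho g) @: xi (d - k')%N p <= xi (d - k')%N p)%VS.
  by have [eA _] := attrP; rewrite -[X in (X <= _)%VS]/(PGL_act _ _) eA.
have hB : (PGL_lift (rho g) @: xi k' q <= xi k' q)%VS.
  rewrite -[X in (X <= _)%VS]/(PGL_act _ _) -limit_equivariant ?gq //.
  exact: ltnW.
have AB0' : (xi (d - k')%N p :&: xi k' q = 0)%VS by rewrite capvC.
have ABE' : (xi (d - k')%N p + xi k' q = fullv)%VS by rewrite addvC.
have evO := attracting_complement AB0' ABE' hA hB attrP dimW WB0 nO.
have [n [On subn]] := filter_ex (filterI evO (attrU _ nN)).
have iterW m : iter m (PGL_act (rho g)) W =
    (xi (k - k')%N (iter m (boundary_act g) s) + xi (d - k)%N p)%VS.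
  elim: m => //= m ->; rewrite PGL_act_add -limit_equivariant ?leq_subr //.
  by rewrite -limit_coequivariant ?gp // k_gt0 leqnn.
exists (iter n (boundary_act g) s); split.
- by apply: subn; exists s.
- have -> : p = iter n (boundary_act g) p by elim: n {On subn} => //= m <-.
  elim: (n) => //= m IHm /(can_inj (boundary_actK g)); exact: IHm.
- by rewrite -iterW.
Qed.

(** Translate an attracting pair by a group element that moves one of the
    attracting points of [g] and of its inverse close to [x]. *)
Lemma approximation k' x (N : set (boundary G)) (O1 O2 : set (Grass E)) :
  (0 < k' < k)%N -> nbhs x N -> open O1 -> open O2 ->
  O1 (xi (d - k')%N x) -> O2 (xi (d - k)%N x) ->
  exists p t, [/\ N p, N t, t <> p, O2 (xi (d - k)%N p) &
    O1 (xi (k - k')%N t + xi (d - k)%N p)%VS].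
Proof.
move=> k'P nN oO1 oO2 O1x O2x; have /andP[k'0 k'k] := k'P.
have k'kk : (0 < k' <= k)%N by rewrite k'0 ltnW.
have kk : (0 < k <= k)%N by rewrite k_gt0 leqnn.
have [_ _ _ [_ eq_k'] [_ cont_k'] _ [_ dyn] _] := limit_anosov k'kk.
have [_ _ _ [_ eq_k] [_ cont_k] _ _ _] := limit_anosov kk.
have [g g_inf] := surface_group_infinite_order hG.
have [_ [p1 att1 attr1]] := dyn _ g_inf.
have [_ [p2 att2 attr2]] := dyn _ (infinite_orderV g_inf).
have p12 : p1 <> p2.
  move=> p12; rewrite -p12 in att2.
  apply: (attracting_inverse _ att1 att2) => [y|y|V].
  - by rewrite -boundary_actM mulgV boundary_act1.
  - exact: (homeo_circle_t1 hphi).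
  - exact: (homeo_circle_not_isolated hphi).
have fix_inv h p : boundary_act h^-1%g p = p -> boundary_act h p = p.
  by move=> {1}<-; rewrite -boundary_actM mulgV boundary_act1.
pose M := N° `&` (xi (d - k)%N @^-1` O2) `&` (xi (d - k')%N @^-1` O1).
have nM : nbhs x M.
  apply: filterI; first apply: filterI.
  - exact: nbhs_interior.
  - by apply: cont_k; apply: open_nbhs_nbhs.
  - by apply: cont_k'; apply: open_nbhs_nbhs.
suff main : forall g p q h, attracting_fixed_point (boundary_act g) p ->
    attracting_fixed_point (PGL_act (rho g)) (xi (d - k')%N p) ->
    boundary_act g q = q -> q <> p -> M (boundary_act h p) ->
    exists p t, [/\ N p, N t, t <> p, O2 (xi (d - k)%N p) &
      O1 (xi (k - k')%N t + xi (d - k)%N p)%VS].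
  have [h [Mh|Mh]] := orbits_dense p12 nM.
    apply: (main g p1 p2 h) => //; last by move/esym.
    by apply: fix_inv; case: att2.
  apply: (main g^-1%g p2 p1 h) => //.
  by apply: fix_inv; rewrite invgK; case: att1.
move=> g0 p q h attp attxi gq qp [[Nhp O2hp] O1hp].
have nN' : nbhs p (boundary_act h @^-1` N) by exact: boundary_act_continuous.
have nO' : nbhs (xi (d - k')%N p) (PGL_act (rho h) @^-1` O1).
  apply: (Grass_img_continuous (lker_PGL_lift (rho h))).
  by apply: open_nbhs_nbhs; split => //; rewrite -[X in O1 X]/(PGL_act _ _) -eq_k'.
have [t [Nt tp Ot]] := attracted_pair k'P attp attxi gq qp nN' nO'.
exists (boundary_act h p), (boundary_act h t); split => //.
- exact: nbhs_singleton.
- by move=> /(can_inj (boundary_actK h)).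
- rewrite limit_equivariant ?leq_subr // eq_k -PGL_act_add; exact: Ot.
Qed.

Lemma msof_img_rows (X : vectType R) a (M : 'M[R]_(a, d)) (h : 'Hom(E, X)) (V : {vspace E}) :
  row_span M = V ->
  (M *m mxof e (vbasis {:X}) h :=: msof (vbasis {:X}) (h @: V))%MS.
Proof.
move=> <-; apply: eqmx_sym; apply: eqmx_trans (msof_img e_basis (vbasisP fullv) _ _) _.
by apply: eqmxMr; exact: msof_row_span.
Qed.

(** The cross ratio inequality in E / p^(d-k), with the determinants in the
    quotient rewritten as determinants in E. *)
Lemma limit_cross_ratio k' p t s ys (n : boundary G -> nat) l
    (MT MS : 'M[R]_(k - k', d)) (MY MZ : 'M[R]_(k', d)) (P : 'M[R]_(l, d)) :
  (0 < k' < k)%N -> (0 < size ys)%N -> (\sum_(y <- ys) n y)%N = k' ->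
  p \notin [:: t, s & ys] ->
  positively_oriented phi (fun i : 'I_(size ys).+2 => nth p [:: t, s & ys] i) ->
  row_span MT = xi (k - k')%N t -> row_span MS = xi (k - k')%N s ->
  row_span MY = (\sum_(y <- ys) xi (n y) y)%VS -> row_span MZ = xi k' (last p ys) ->
  row_free P -> row_span P = xi (d - k)%N p ->
  `|rdet (col_mx (col_mx MY MS) P)| * `|rdet (col_mx (col_mx MZ MT) P)| <=
  `|rdet (col_mx (col_mx MY MT) P)| * `|rdet (col_mx (col_mx MZ MS) P)|.
Proof.
move=> /andP[k'0 k'k]; case: ys => // y0 ys _ sum_n p_notin orient eT eS eY eZ fP eP.
have kd := k_ltd.
have kk : (0 < k <= k)%N by rewrite k_gt0 leqnn.
have lE : l = (d - k)%N by rewrite -(limit_codim p kk) -eP dim_row_span.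
have [|c c0 cE] := @rdet_quot R E _ (k' + (k - k')) l P fP eP; first by lia.
set h := quot_proj _ in cE.
have pts (i : 'I_(size ys).+3) : nth p [:: t, s, y0 & ys] i <> p.
  move=> pi_p; have := p_notin; rewrite -{1}pi_p mem_nth //.
have pos := @positive_quot p (size ys).+3 _ ltac:(lia) isT pts orient.
have := @positive_tuple_cross R _ (size ys) _
  (fun j => n (nth p (y0 :: ys) j)) (k - k')%N k'
  (MS *m mxof e (vbasis fullv) h) (MT *m mxof e (vbasis fullv) h)
  (MY *m mxof e (vbasis fullv) h) (MZ *m mxof e (vbasis fullv) h) pos.
move=> cross.
rewrite !cE !normrM !mul_col_mx.
rewrite mulrACA [X in _ <= X]mulrACA ler_wpM2l ?mulr_ge0 //; apply: cross.
- by move=> i; rewrite /pi_quot limit_map0 limg0.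
- by lia.
- by rewrite dim_quot_space limit_codim // subKn ?(ltnW kd) // subnK // ltnW.
- by [].
- by rewrite -[RHS]sum_n [RHS](big_nth p) big_mkord.
- exact: msof_img_rows.
- exact: msof_img_rows.
- suff -> : (\sum_(j < (size ys).+1)
     pi_quot k xi p (nth p [:: t, s, y0 & ys] (lift ord0 (lift ord0 j)))
       (n (nth p (y0 :: ys) j)) = h @: (\sum_(y <- y0 :: ys) xi (n y) y))%VS.
    exact: msof_img_rows.
  by rewrite limg_sum (big_nth p) big_mkord; apply: eq_bigr => j _.
- rewrite /pi_quot; apply: msof_img_rows; rewrite eZ; congr (xi k' _).
  by rewrite (last_nth p).
Qed.

Lemma rdet_col_mxA a b l m (A : 'M[R]_(a, m)) (B : 'M[R]_(b, m)) (C : 'M[R]_(l, m)) :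
  rdet (col_mx A (col_mx B C)) = rdet (col_mx (col_mx A B) C).
Proof.
have castE p q (eq_pq : p = q) (M : 'M[R]_(p, m)) :
    rdet (castmx (eq_pq, erefl m) M) = rdet M by case: q / eq_pq.
by rewrite col_mxA castE.
Qed.

(** Let r be the ratio |det(Y,s^c,V)| / |det(Z,s^c,V)| at V = x^(d-k).  It exceeds
    r / 2 for all V near x^(d-k), whereas, if det(Y, x^(d-k')) vanished,
    |det(Y,W)| / |det(Z,W)| would be less than r / 2 for all W near x^(d-k').  An
    approximating pair, with V = p^(d-k) and W = t^c + p^(d-k), then contradicts
    the cross ratio inequality. *)
Lemma span_at_codim k' x ys (n : boundary G -> nat) : (0 < k' <= k)%N ->
  uniq ys -> x \notin ys -> (\sum_(y <- ys) n y)%N = k' ->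
  (\sum_(y <- ys) xi (n y) y + xi (d - k')%N x)%VS = fullv.
Proof.
move=> /andP[k'0]; rewrite leq_eqVlt => /orP[/eqP -> |k'k] uys xys sum_n.
  exact: span_at_codim_k.
have k'P : (0 < k' < k)%N by rewrite k'0.
have k'kk : (0 < k' <= k)%N by rewrite k'0 ltnW.
have kk : (0 < k <= k)%N by rewrite k_gt0 leqnn.
have kd := k_ltd.
have [ys' [s [permys sx sys near_x]]] := cyclic_order hphi uys xys.
have size_ys' : (0 < size ys')%N.
  by rewrite lt0n size_eq0; apply/eqP => ys0; move: k'0; rewrite -sum_n -(perm_big _ permys) ys0 big_nil.
pose ym := last x ys'.
have ym_ys : ym \in ys.
  by rewrite -(perm_mem permys) /ym; case: (ys') size_ys' => //= y s' _; exact: mem_last.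
pose Y : {vspace E} := (\sum_(y <- ys) xi (n y) y)%VS.
have fullYS : (Y + xi (k - k')%N s + xi (d - k)%N x)%VS = fullv.
  have := @span_at_codim_k x (s :: ys) (fun y => if y == s then (k - k')%N else n y).
  rewrite !big_cons eqxx.
  have E1 : (\sum_(j <- ys) (if j == s then (k - k')%N else n j))%N = k'.
    rewrite -sum_n !big_seq; apply: eq_bigr => y yys.
    by case: eqP => // ys_; move: sys; rewrite -ys_ yys.
  have E2 : (\sum_(j <- ys) xi (if j == s then k - k' else n j)%N j)%VS = Y.
    rewrite /Y !big_seq; apply: eq_bigr => y yys.
    by case: eqP => // ys_; move: sys; rewrite -ys_ yys.
  rewrite E1 E2 (addvC (xi (k - k')%N s)); apply.
  - by rewrite /= sys.
  - by rewrite inE negb_or xys andbT; apply/eqP => /esym.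
  - by rewrite subnK // ltnW.
have nk' y : y \in ys -> (n y <= k')%N by move=> yys; rewrite -sum_n sum_le_mem.
have dimY_le : (\dim Y <= k')%N.
  rewrite -sum_n /Y big_seq [X in (_ <= X)%N]big_seq.
  apply: leq_trans (dimv_leq_sum _ _ _) _; apply: leq_sum => y yys.
  by rewrite limit_dim // (leq_trans (nk' y yys)) // ltnW.
have dimS z : \dim (xi (k - k')%N z) = (k - k')%N by rewrite limit_dim // leq_subr.
have dimY : \dim Y = k'.
  apply/eqP; rewrite eqn_leq dimY_le /=.
  have := dimv_add_leqif (Y + xi (k - k')%N s)%VS (xi (d - k)%N x) => /leqifP.
  have := dimv_add_leqif Y (xi (k - k')%N s) => -[le1 _].
  have := dimv_add_leqif (Y + xi (k - k')%N s)%VS (xi (d - k)%N x) => -[le2 _] _.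
  by move: le1 le2; rewrite fullYS dimS limit_codim //; lia.
have [MY fMY eY] := row_span_surj dimY.
have [MZ fMZ eZ] := row_span_surj (limit_dim ym (ltnW k'k)).
have [MS fMS eS] := row_span_surj (dimS s).
have [P0 fP0 eP0] := row_span_surj (limit_codim x kk).
have szs1 : (k' + (k - k') + (d - k))%N = d by rewrite !subnKC // ltnW.
have szs2 : (k' + (k - k' + (d - k)))%N = d by rewrite addnA.
have dimQ : \dim (xi (d - k')%N x) = (k - k' + (d - k))%N.
  rewrite limit_codim //; apply: (@addnI k'); rewrite szs2 subnKC //.
  exact: ltnW (ltn_trans k'k kd).
have [Q0 fQ0 eQ0] := row_span_surj dimQ.
have ymx : ym <> x by move=> ymx; move: xys; rewrite -ymx ym_ys.
have yms : ym <> s by move=> yms; move: sys; rewrite -yms ym_ys.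
pose D1 := `|rdet (col_mx (col_mx MY MS) P0)|.
pose D2 := `|rdet (col_mx (col_mx MZ MS) P0)|.
have D1_gt0 : 0 < D1.
  by rewrite normr_gt0; apply/(rdet_col_neq0 _ _ szs1); rewrite row_span_col eY eS eP0.
have D2_gt0 : 0 < D2.
  rewrite normr_gt0; apply/(rdet_col_neq0 _ _ szs1); rewrite row_span_col eZ eS eP0.
  by rewrite [X in (X + _)%VS]addvC; apply: span_two_at_codim_k => // /esym.
have D3_gt0 : 0 < `|rdet (col_mx MZ Q0)|.
  rewrite normr_gt0; apply/(rdet_col_neq0 _ _ szs2); rewrite eZ eQ0.
  by have [] := limit_transverse k'kk ymx.
rewrite -/Y -eY -eQ0; apply/(rdet_col_neq0 _ _ szs2); apply/eqP => D0.
(* The factor 2 leaves room for the ratio D1 / D2 to vary near x. *)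
pose C1 (Q : 'M[R]_(k - k' + (d - k), d)) :=
  D2 *+ 2 * `|rdet (col_mx MY Q)| < D1 * `|rdet (col_mx MZ Q)|.
pose C2 (P : 'M[R]_(d - k, d)) :=
  D1 * `|rdet (col_mx (col_mx MZ MS) P)| < D2 *+ 2 * `|rdet (col_mx (col_mx MY MS) P)|.
pose O1 : set (Grass E) := [set V | exists2 M, row_free M /\ C1 M & row_span M = V].
pose O2 : set (Grass E) := [set V | exists2 M, row_free M /\ C2 M & row_span M = V].
have oO1 : open O1.
  apply: Grass_open_bases => [M|h M hu]; [exact: near_rdet_lt | exact: rdet_lt_mul].
have oO2 : open O2.
  apply: Grass_open_bases => [M|h M hu]; [exact: near_rdet_lt | exact: rdet_lt_mul].
have O1x : O1 (xi (d - k')%N x).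
  by exists Q0 => //; split => //; rewrite /C1 D0 normr0 mulr0 mulr_gt0.
have O2x : O2 (xi (d - k)%N x).
  exists P0 => //; split => //; rewrite /C2 -/D1 -/D2 mulrC ltr_pM2r // mulr2n.
  by rewrite ltrDl.
have near_x' : nbhs x [set t | [/\ t \notin s :: ys & positively_oriented phi
     (fun i : 'I_(size ys').+2 => nth x [:: t, s & ys'] i)]].
  by apply: filterS near_x => t [ts [tys orient]]; split => //; rewrite inE negb_or tys andbT; exact/eqP.
have [p [t [[p_ys _] [t_ys orient] tp [P [fP C2P] eP] [Q [fQ C1Q] eQ]]]] :=
  approximation k'P near_x' oO1 oO2 O1x O2x.
have [MT fMT eT] := row_span_surj (dimS t).
have [hQ hQ_unit TPE] : exists2 h, h \in unitmx & col_mx MT P = h *m Q.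
  apply/eqmxMunitP/eqmxP/row_span_eqmx.
  by rewrite row_span_col eT eP eQ.
have {}C1Q : C1 (col_mx MT P) by rewrite TPE; exact: rdet_lt_mul.
have nthE : (fun i : 'I_(size ys').+2 => nth x [:: t, s & ys'] i)
    = (fun i : 'I_(size ys').+2 => nth p [:: t, s & ys'] i).
  by apply: funext => i; exact: set_nth_default.
rewrite nthE in orient.
have := @limit_cross_ratio k' p t s ys' n _ MT MS MY MZ P k'P size_ys'.
rewrite (perm_big _ permys) => /(_ sum_n _ orient eT eS).
rewrite (perm_big _ permys) => /(_ _ eY _ fP eP) cross.
have {cross} : `|rdet (col_mx (col_mx MY MS) P)| * `|rdet (col_mx (col_mx MZ MT) P)| <=
  `|rdet (col_mx (col_mx MY MT) P)| * `|rdet (col_mx (col_mx MZ MS) P)|.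
  apply: cross.
    rewrite inE negb_or; apply/andP; split; first by apply/eqP => /esym.
    by move: p_ys; rewrite !inE (perm_mem permys).
  by rewrite eZ /ym; case: (ys') size_ys'.
rewrite leNgt => /negP; apply.
move: C1Q C2P; rewrite /C1 /C2 !rdet_col_mxA.
set a := `|rdet (col_mx (col_mx MY MS) P)|; set b := `|rdet (col_mx (col_mx MZ MT) P)|.
set f := `|rdet (col_mx (col_mx MY MT) P)|; set g := `|rdet (col_mx (col_mx MZ MS) P)|.
move=> lt1 lt2.
have D2' : 0 < D2 *+ 2 by rewrite pmulrn_lgt0.
have f0 : 0 <= f := normr_ge0 _; have g0 : 0 <= g := normr_ge0 _.
have : D2 *+ 2 * f * (D1 * g) < D1 * b * (D2 *+ 2 * a).
  by apply: ltr_pM => //; apply: mulr_ge0 => //; exact: ltW.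
rewrite (_ : D2 *+ 2 * f * (D1 * g) = (D2 *+ 2 * D1) * (f * g)); last by ring.
rewrite (_ : D1 * b * (D2 *+ 2 * a) = (D2 *+ 2 * D1) * (a * b)); last by ring.
by rewrite ltr_pM2l // mulr_gt0.
Qed.

End KPositive.

Theorem proposition6p17
  (R : realType) (G : hyperbolicGroup) (hG : surface_group G)
  (phi : boundary G -> R * R) (hphi : homeo_circle phi)
  (E : vectType R) (rho : {multiplicative G -> PGL E})
  (k : nat) (hrho : k_positive rho phi k)
  (xi : nat -> boundary G -> Grass E) (hxi : limit_maps rho k xi)
  (i : nat) (x : 'I_i.+1 -> boundary G) (hx : injective x)
  (n : 'I_i.+1 -> nat) (hn0 : forall j, (0 < n j)%N)
  (hsum : (\sum_(j < i.+1) n j <= \dim {:E})%N)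
  (hlast : (\dim {:E} - k <= n ord_max)%N) :
  directv (\sum_(j < i.+1) xi (n j) (x j))%VS.
Proof.
case: i x hx n hn0 hsum hlast => [|i] x hx n hn0 hsum hlast.
  by rewrite directvE /= !big_ord1.
have kd := k_ltd hrho hxi.
pose k' := (\dim {:E} - n ord_max)%N.
pose others := (\sum_(j < i.+1) n (widen_ord (leqnSn _) j))%N.
have sumE : (\sum_j n j)%N = (others + n ord_max)%N by rewrite big_ord_recr.
rewrite sumE in hsum.
have others_gt0 : (0 < others)%N by rewrite /others big_ord_recl ltn_addr.
have k'P : (0 < k' <= k)%N by rewrite /k'; lia.
have nE : n ord_max = (\dim {:E} - k')%N by rewrite /k'; lia.
pose y j := x (widen_ord (leqnSn _) j).
pose ys := [seq y j | j <- index_enum 'I_i.+1].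
have y_inj : injective y.
  by move=> a b /hx /(congr1 val) /= ab; exact: val_inj.
have uys : uniq ys by rewrite map_inj_uniq // index_enum_uniq.
have x_ys : x ord_max \notin ys.
  apply/mapP => -[j _ /hx /(congr1 val) /= ij].
  by have := ltn_ord j; rewrite -ij ltnn.
(* An extra point z absorbs the difference between d and the sum of the
   multiplicities. *)
have [z [zx zys]] := fresh_point hphi x_ys.
pose m w := if w == z then (k' - others)%N else (\sum_(j | y j == w) n (widen_ord (leqnSn _) j))%N.
have my j : m (y j) = n (widen_ord (leqnSn _) j).
  rewrite /m; case: eqP => [yz|_].
    by case/negP: zys; rewrite -yz; apply: map_f; rewrite mem_index_enum.
  by rewrite (big_pred1 j) // => l; rewrite /= (inj_eq y_inj).
have mz : m z = (k' - others)%N by rewrite /m eqxx.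
have sum_ys (V : Type) (idx : V) (op : Monoid.law idx) (F : boundary G -> V) :
    \big[op/idx]_(w <- ys) F w = \big[op/idx]_(j < i.+1) F (y j).
  by rewrite big_map.
have := span_at_codim hG hphi hrho hxi (x := x ord_max) (ys := z :: ys) (n := m) k'P.
rewrite !big_cons /= zys uys inE negb_or x_ys andbT => /(_ isT) full.
have sum_y : (\sum_(w <- ys) xi (m w) w =
    \sum_(j < i.+1) xi (n (widen_ord (leqnSn _) j)) (y j))%VS.
  by rewrite sum_ys; apply: eq_bigr => j _; rewrite my.
have {}full : (xi (m z) z + (\sum_(j < i.+1) xi (n (widen_ord (leqnSn _) j)) (y j) +
    xi (n ord_max) (x ord_max)))%VS = fullv.
  rewrite addvA -sum_y nE; apply: full; first by rewrite andbT; apply/eqP => /esym.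
  rewrite mz sum_ys; under eq_bigr do rewrite my.
  by rewrite -/others subnK // /k'; lia.
have dim_max : \dim (xi (n ord_max) (x ord_max)) = n ord_max.
  by rewrite nE (limit_codim hxi).
have dim_j j : \dim (xi (n j) (x j)) = n j.
  have [j' ->|->] := unliftP ord_max j; last exact: dim_max.
  apply: (limit_dim hxi); apply: leq_trans (_ : others <= _)%N; last by rewrite /k' in k'P; lia.
  have -> : lift ord_max j' = widen_ord (leqnSn _) j' by apply: val_inj; rewrite /= /bump leqNgt ltn_ord.
  by rewrite /others (bigD1 j') //= leq_addr.
rewrite directvEgeq /= (eq_bigr n) => [|j _]; last exact: dim_j.
rewrite sumE big_ord_recr /=.
pose S := (\sum_(j < i.+1) xi (n (widen_ord (leqnSn _) j)) (y j) + xi (n ord_max) (x ord_max))%VS.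
suff : (others + n ord_max <= \dim S)%N by [].
have [le_d _] := dimv_add_leqif (xi (m z) z) S.
have mk : (m z <= k)%N by rewrite mz; lia.
move: le_d; rewrite full (limit_dim hxi) // mz /k' => le_d.
by rewrite /k' in k'P; lia.
Qed.
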